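(* Let $N\ge 1$, $d\ge 1$, let $f\in\mathcal C_N$ and let $\mathbf p=(\mathbf p_1,\dots,\mathbf p_N)\in(\mathbb R^d)^N$ be a fixed system of centers. Let $\mathcal V_f^d(\mathbf p,r)=\mathrm{vol}_d\big(f(B^d(\mathbf p_1,r),\dots,B^d(\mathbf p_N,r))\big)$. Then, as $r\to\infty$, $$\mathcal V_f^d(\mathbf p,r)=\sum_{k=d-2}^{d}\binom dk W_{f,k}^d(\mathbf p)\,r^k+O(r^{d-3})=\sum_{k=0}^{2}\kappa_{d-k}V_{f,k}(\mathbf p)\,r^{d-k}+O(r^{d-3}).$$
   Context: $\mathrm{vol}_d$ is $d$-dimensional volume, $\kappa_n$ is the volume of the unit ball of $\mathbb R^n$ ($\kappa_0=1$), and $B^d(\mathbf x,r)$ is the closed ball of radius $r$ about $\mathbf x\in\mathbb R^d$. Boolean algebra. $\mathcal B_N$ is the free Boolean algebra generated by $x_1,\dots,x_N$, with operations $\cup,\cap$, complement $f\mapsto\bar f$, greatest element $X$, least element $\emptyset$; $f\setminus g=f\cap\bar g$, and $f\subseteq g$ means $f\cup g=g$. Put $[N]=\{1,\dots,N\}$. $\mathcal C_N\subset\mathcal B_N$ is the set of elements that can be built from $x_1,\dots,x_N$ using only $\cup,\cap,\setminus$. For subsets $A_1,\dots,A_N$ of a set, $f(A_1,\dots,A_N)$ is obtained by substituting $x_i=A_i$ and interpreting $\cup,\cap,\setminus$ as set operations. For $\emptyset\ne I\subseteq[N]$ let $u_I=\bigcup_{i\in I}x_i$. $\mathcal M_N$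 is the space of functions $\mu:\mathcal C_N\to\mathbb R$ with $\mu(f\cup g)=\mu(f)+\mu(g)$ whenever $f\cap g=\emptyset$. For each $f\in\mathcal C_N$, the integers $m_{f,I}$ ($\emptyset\neq I\subseteq[N]$) are the unique ones such that $\mu(f)=\sum_{\emptyset\ne I\subseteq[N]}m_{f,I}\,\mu(u_I)$ for all $\mu\in\mathcal M_N$. Intrinsic volumes. For a nonempty compact convex $K\subset\mathbb R^d$, the quermassintegrals $W_k^d(K)$ and intrinsic volumes $V_k(K)$ are defined by Steiner's formula $\mathrm{vol}_d(K+B^d(\mathbf 0,r))=\sum_{k=0}^d\binom dk W^d_k(K)r^k=\sum_{k=0}^d\kappa_{d-k}V_k(K)r^{d-k}$ for $r\ge0$; $V_k(K)=0$ for $k>d$. For $\mathbf p\in(\mathbb R^d)^N$, $K_I(\mathbf p)$ is the convex hull of $\{\mathbf p_i: i\in I\}$. For $f\in\mathcal C_N$, $$W^d_{f,k}(\mathbf p)=\sum_{\emptyset\ne I\subseteq[N]}m_{f,I}W^d_k(K_I(\mathbf p)),\qquad V_{f,k}(\mathbf p)=\sum_{\emptyset\ne I\subseteq[N]}m_{f,I}V_k(K_I(\mathbf p)).$$ If $d=1$, the terms with $d-2=-1$ as power of $r$ are read as $0$. *)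

(* Defs.v *)
From HB Require Import structures.
From mathcomp Require Import all_boot all_order all_algebra.
From mathcomp Require Import all_classical all_reals all_analysis.

Set Implicit Arguments.
Unset Strict Implicit.
Unset Printing Implicit Defensive.

Import Order.TTheory GRing.Theory Num.Theory.
Import numFieldNormedType.Exports.

Local Open Scope classical_set_scope.
Local Open Scope ring_scope.

(* Pushforward of lebesgue_measure \x m along (x, t) |-> x :: t.                *)
Section LebesgueTuple.
Context {R : realType} (n : nat).
Variable m : {sigma_finite_measure set (n.-tuple (measurableTypeR R)) -> \bar R}.

Let T := measurableTypeR R.

Let consp (q : T * n.-tuple T) : n.+1.-tuple T := [the n.+1.-tuple T of q.1 :: q.2].

Let measurable_consp : measurable_fun [set: T * n.-tuple T] consp.
Proof. exact: measurable_cons. Qed.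

Definition cons_measure : set (n.+1.-tuple (measurableTypeR R)) -> \bar R :=
  pushforward (lebesgue_measure \x m)%E consp.

Let cons_measure0 : cons_measure set0 = 0%E.
Proof. by rewrite /cons_measure /pushforward preimage_set0 measure0. Qed.

Let mpre A : measurable A -> measurable (consp @^-1` A).
Proof. by move=> mA; rewrite -[X in measurable X]setTI; exact: measurable_consp. Qed.

Let cons_measure_ge0 A : (0 <= cons_measure A)%E.
Proof. exact: measure_ge0. Qed.

Let cons_measure_sigma_additive : semi_sigma_additive cons_measure.
Proof.
move=> F mF tF mUF; rewrite /cons_measure /pushforward preimage_bigcup.
apply: measure_semi_sigma_additive.
- by move=> k; exact: mpre.
- apply/trivIsetP => /= i j _ _ ij; rewrite -preimage_setI.
  by move/trivIsetP : tF => /(_ _ _ _ _ ij) ->//; rewrite preimage_set0.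
- by rewrite -preimage_bigcup; exact: mpre.
Qed.

HB.instance Definition _ := isMeasure.Build _ _ _ cons_measure
  cons_measure0 cons_measure_ge0 cons_measure_sigma_additive.

Let cons_measure_sigma_finite : sigma_finite setT cons_measure.
Proof.
have /sigma_finiteP[F [TF ndF Foo]] := sigma_finiteT (@lebesgue_measure R).
have /sigma_finiteP[G [TG ndG Goo]] := sigma_finiteT m.
have FGT : \bigcup_k (F k `*` G k) = setT.
  apply/seteqP; split => // -[x t] _.
  have [i _ Fx] : (\bigcup_k F k) x by rewrite -TF.
  have [j _ Gt] : (\bigcup_k G k) t by rewrite -TG.
  exists (maxn i j) => //; split => /=.
    by move: x Fx; exact/subsetPset/ndF/leq_maxl.
  by move: t Gt; exact/subsetPset/ndG/leq_maxr.
pose g (t : n.+1.-tuple T) : T * n.-tuple T := (thead t, [tuple of behead t]).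
have mg : measurable_fun setT g.
  apply: measurable_fun_pair => /=.
    exact: (@measurable_tnth _ T n.+1 ord0).
  exact: measurable_behead.
have gK : cancel consp g.
  by move=> [x t]; rewrite /g /consp /=; congr pair; exact: val_inj.
exists (fun k => g @^-1` (F k `*` G k)).
  by rewrite -preimage_bigcup FGT preimage_setT.
move=> k; have [mF Fk] := Foo k; have [mG Gk] := Goo k; split.
  by rewrite -[X in measurable X]setTI; apply: mg => //; exact: measurableX.
rewrite /cons_measure /pushforward (_ : _ @^-1` _ = F k `*` G k).
  by rewrite product_measure1E// lte_mul_pinfty// ge0_fin_numE.
by apply/funext => q; exact: (congr1 (F k `*` G k) (gK q)).
Qed.

HB.instance Definition _ := Measure_isSigmaFinite.Build _ _ _ cons_measure
  cons_measure_sigma_finite.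

End LebesgueTuple.

Fixpoint lebesgue_tuple (R : realType) (n : nat) :
    {sigma_finite_measure set (n.-tuple (measurableTypeR R)) -> \bar R} :=
  match n with
  | 0 => \d_ [tuple]
  | n'.+1 => cons_measure (lebesgue_tuple R n')
  end.

Lemma lebesgue_tuple_box (R : realType) (n : nat)
    (A : 'I_n -> set (measurableTypeR R)) : (forall i, measurable (A i)) ->
  (lebesgue_tuple R n [set t | forall i, A i (tnth t i)] =
   \prod_(i < n) lebesgue_measure (A i))%E.
Proof.
elim: n A => [|n IH] A mA.
  rewrite big_ord0 /= diracE mem_set//= => i.
  by case: i.
pose B := [set t : n.-tuple (measurableTypeR R) | forall i, A (lift ord0 i) (tnth t i)].
have mB : measurable B.
  rewrite (_ : B = \bigcap_(i in [set: 'I_n])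
      ((@tnth n (measurableTypeR R))^~ i @^-1` A (lift ord0 i))).
    apply: fin_bigcap_measurable => // i _.
    by rewrite -[X in measurable X]setTI; exact: measurable_tnth.
  by apply/seteqP; split => t /= tA i; [move=> _; exact: tA | exact: tA].
rewrite big_ord_recl -IH; last by move=> i; exact: mA.
rewrite /= /cons_measure /pushforward.
rewrite (_ : _ @^-1` _ = A ord0 `*` B); first by rewrite product_measure1E.
apply/seteqP; split => -[x t] /=.
  move=> At; split; first exact: (At ord0).
  by move=> i; have := At (lift ord0 i); rewrite tnthS.
move=> [/= Ax Bt] i; case: (unliftP ord0 i) => [j ->|->]; last exact: Ax.
by rewrite tnthS; exact: Bt.
Qed.

(* The free Boolean algebra on x_0, ..., x_(N-1), realized as the power set   *)
(* of its set of atoms. The atom J : {set 'I_N} is the meet of the x_i, i in  *)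
(* J, and of the complements of the x_i, i not in J, so that an element is    *)
(* identified with the set of truth assignments that satisfy it.              *)
Definition freeBA (N : nat) := set {set 'I_N}.

Definition gen (N : nat) (i : 'I_N) : freeBA N := [set J | i \in J].

Inductive cterm (N : nat) : Type :=
| CVar of 'I_N
| CCup of cterm N & cterm N
| CCap of cterm N & cterm N
| CDiff of cterm N & cterm N.

(* With A := @gen N this is the element of freeBA N denoted by a term.        *)
Fixpoint ceval (N : nat) (T : Type) (A : 'I_N -> set T) (t : cterm N) : set T :=
  match t with
  | CVar i => A i
  | CCup t1 t2 => ceval A t1 `|` ceval A t2
  | CCap t1 t2 => ceval A t1 `&` ceval A t2
  | CDiff t1 t2 => ceval A t1 `\` ceval A t2
  end.

Definition CN (N : nat) : set (freeBA N) := range (ceval (@gen N)).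

Lemma ceval_gen (N : nat) (T : Type) (A : 'I_N -> set T) (t : cterm N) (x : T) :
  ceval A t x <-> ceval (@gen N) t [set i | `[< A i x >]]%SET.
Proof.
elim: t => [i|t1 IH1 t2 IH2|t1 IH1 t2 IH2|t1 IH1 t2 IH2] /=.
- by rewrite /gen /= inE; split => /asboolP.
- by rewrite /setU/=; tauto.
- by rewrite /setI/=; tauto.
- by rewrite /setD/=; tauto.
Qed.

(* Two terms denote the same element of freeBA N exactly when the identity    *)
(* they form holds in every algebra of sets.                                  *)
Lemma freeBA_eqP (N : nat) (s t : cterm N) :
  ceval (@gen N) s = ceval (@gen N) t <->
  forall (T : Type) (A : 'I_N -> set T), ceval A s = ceval A t.
Proof.
split=> [st T A|]; last exact.
apply/funext => x; apply/propext.
by split=> /(ceval_gen A _ x).1 h; apply/(ceval_gen A _ x).2; [rewrite -st|rewrite st].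
Qed.

(* f(A_0, ..., A_(N-1)), by substitution in a term t denoting f; the union    *)
(* over all such t is harmless by csubstE.                                    *)
Definition csubst (N : nat) (f : freeBA N) (T : Type) (A : 'I_N -> set T) : set T :=
  \bigcup_(t in [set t | ceval (@gen N) t = f]) ceval A t.

Lemma csubstE (N : nat) (t : cterm N) (T : Type) (A : 'I_N -> set T) :
  csubst (ceval (@gen N) t) A = ceval A t.
Proof.
apply/seteqP; split => [x [s /= /freeBA_eqP ->]//|x tx].
by exists t.
Qed.

Definition ugen (N : nat) (I : {set 'I_N}) : freeBA N :=
  \bigcup_(i in [set` I]) gen i.

(* The space of valuations on CN; the values of mu outside CN are irrelevant. *)
Definition additive_on_CN (R : realType) (N : nat) (mu : freeBA N -> R) : Prop :=
  forall f g, CN f -> CN g -> f `&` g = set0 -> mu (f `|` g) = mu f + mu g.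

(* Only the values at nonempty I are determined by f; m I for I = set0 is     *)
(* never used.                                                                *)
Definition mcoef (R : realType) (N : nat) (f : freeBA N) : {ffun {set 'I_N} -> int} :=
  xget 0 [set m : {ffun {set 'I_N} -> int} |
    forall mu : freeBA N -> R, additive_on_CN mu ->
      mu f = \sum_(I : {set 'I_N} | I != finset.set0) (m I)%:~R * mu (ugen I)].

Definition vol (R : realType) (n : nat) (A : set 'rV[R]_n) : \bar R :=
  lebesgue_tuple R n [set t | A (\row_i tnth t i)].

(* The library norm `|x| on matrices is the maximum norm.                     *)
Definition enorm (R : realType) (n : nat) (x : 'rV[R]_n) : R :=
  Num.sqrt (\sum_i x ord0 i ^+ 2).

Definition cball (R : realType) (n : nat) (x : 'rV[R]_n) (r : R) : set 'rV[R]_n :=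
  [set y | enorm (y - x) <= r].

Definition kappa (R : realType) (n : nat) : R := fine (vol (@cball R n 0 1)).

Definition minkowski_sum (R : realType) (n : nat) (A B : set 'rV[R]_n) : set 'rV[R]_n :=
  [set z | exists x, exists y, [/\ A x, B y & z = x + y]].

(* W and V are the coefficients in Steiner's formula, selected by xget; they  *)
(* are set to 0 above the dimension.                                          *)
Definition quermass (R : realType) (d : nat) (K : set 'rV[R]_d) : nat -> R :=
  xget (fun=> 0) [set W : nat -> R | (forall k, (d < k)%N -> W k = 0) /\
    forall r : R, 0 <= r -> vol (minkowski_sum K (cball 0 r)) =
      (\sum_(k < d.+1) 'C(d, k)%:R * W k * r ^+ k)%:E].

Definition intrinsic_vol (R : realType) (d : nat) (K : set 'rV[R]_d) : nat -> R :=
  xget (fun=> 0) [set V : nat -> R | (forall k, (d < k)%N -> V k = 0) /\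
    forall r : R, 0 <= r -> vol (minkowski_sum K (cball 0 r)) =
      (\sum_(k < d.+1) kappa R (d - k) * V k * r ^+ (d - k))%:E].

Definition conv_hull (R : realType) (d : nat) (S : set 'rV[R]_d) : set 'rV[R]_d :=
  smallest (@convex_set R 'rV[R]_d) S.

Definition hullI (R : realType) (N d : nat) (p : 'I_N -> 'rV[R]_d) (I : {set 'I_N}) :=
  conv_hull [set p i | i in [set` I]].

Definition Wf (R : realType) (N d : nat) (f : freeBA N) (k : nat)
    (p : 'I_N -> 'rV[R]_d) : R :=
  \sum_(I : {set 'I_N} | I != finset.set0) (mcoef R f I)%:~R * quermass (hullI p I) k.

Definition Vf (R : realType) (N d : nat) (f : freeBA N) (k : nat)
    (p : 'I_N -> 'rV[R]_d) : R :=
  \sum_(I : {set 'I_N} | I != finset.set0) (mcoef R f I)%:~R * intrinsic_vol (hullI p I) k.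

(* The set is bounded, so its volume is finite and fine loses nothing.        *)
Definition flower_vol (R : realType) (N d : nat) (f : freeBA N)
    (p : 'I_N -> 'rV[R]_d) (r : R) : R :=
  fine (vol (csubst f (fun i => cball (p i) r))).

(* pinfty_nbhs bundled as a filter, as the Landau notations require.          *)
Definition near_pinfty {R : realType} : filter_on R :=
  FilterType (pinfty_nbhs R) _.

(* Main.v *)
(* By additivity of volume, [flower_vol f] is the combination with coefficients
   [mcoef f I] of the volumes of the unions U_I(r) of the balls of radius r about
   the p_i, i in I, so it suffices to compare U_I(r) with the parallel body
   K + rB of the hull K of these points. A point x of K + rB is q + u with q its
   nearest point in K; sort the points x by the set J of those p_i at which the
   linear form dot(., u) is maximal on K. The piece with index J is, up to a
   translation, stable under the maps q + u |-> q + s u, which are linear, equal to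
   the identity on the direction space of the face spanned by J and to s on its
   orthogonal complement; so its volume is v_J r^m with m the codimension of that
   face, which gives Steiner's formula. If the face is a vertex (m = d), the piece
   lies in one ball. Otherwise m <= d - 1, and Pythagoras shows that the part of
   the piece with |u| <= sqrt (r^2 - D^2), D a bound for the diameter of K, lies in
   the balls; what is left has volume v_J (r^m - (r^2 - D^2)^(m/2)) = O(r^(d-3)). *)
Require Import Defs.
From HB Require Import structures.
From mathcomp Require Import all_boot all_order all_algebra.
From mathcomp Require Import all_classical all_reals all_analysis measurable_realfun.
From mathcomp Require Import lra.
Import Order.TTheory GRing.Theory Num.Theory.
Import numFieldNormedType.Exports.
Local Open Scope classical_set_scope.
Local Open Scope ring_scope.

Set Implicit Arguments.
Unset Strict Implicit.
Unset Printing Implicit Defensive.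

(** * Lebesgue measure on row vectors *)

Lemma measurable_preimageT d1 d2 (T1 : measurableType d1) (T2 : measurableType d2)
    (f : T1 -> T2) (A : set T2) :
  measurable_fun [set: T1] f -> measurable A -> measurable (f @^-1` A).
Proof. by move=> mf mA; rewrite -[X in measurable X]setTI; exact: mf. Qed.

Section row_measurable.
Context {R : realType} {n : nat}.

Definition row_of_tuple (t : n.-tuple (measurableTypeR R)) : 'rV[R]_n :=
  \row_i tnth t i.

Definition tuple_of_row (x : 'rV[R]_n) : n.-tuple (measurableTypeR R) :=
  [tuple x ord0 i | i < n].

Lemma row_of_tupleK : cancel row_of_tuple tuple_of_row.
Proof. by move=> t; apply: eq_from_tnth => i; rewrite tnth_mktuple mxE. Qed.

Lemma tuple_of_rowK : cancel tuple_of_row row_of_tuple.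
Proof. by move=> x; apply/rowP => i; rewrite mxE tnth_mktuple. Qed.

Definition row_measurable_set (A : set 'rV[R]_n) : Prop :=
  measurable (row_of_tuple @^-1` A).

Let rm0 : row_measurable_set set0.
Proof. by rewrite /row_measurable_set preimage_set0. Qed.

Let rmC A : row_measurable_set A -> row_measurable_set (~` A).
Proof. by rewrite /row_measurable_set preimage_setC => /measurableC. Qed.

Let rmU (F : (set 'rV[R]_n)^nat) : (forall i, row_measurable_set (F i)) ->
  row_measurable_set (\bigcup_i F i).
Proof.
move=> mF; rewrite /row_measurable_set preimage_bigcup.
by apply: bigcup_measurable => k _; exact: mF.
Qed.

(* The sigma-algebra transported from tuples, for which [vol] is a measure. *)
HB.instance Definition _ := @isMeasurable.Build
  (measure_tuple_display default_measure_display) 'rV[R]_n row_measurable_set rm0 rmC rmU.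
End row_measurable.

Section row_measurable_theory.
Context {R : realType} {n : nat}.

Lemma measurable_row_of_tuple :
  measurable_fun [set: n.-tuple (measurableTypeR R)] (@row_of_tuple R n).
Proof. by move=> _ A mA; rewrite setTI. Qed.

Lemma measurable_coord (i : 'I_n) :
  measurable_fun [set: 'rV[R]_n] (fun x : 'rV[R]_n => x ord0 i).
Proof.
move=> _ A mA; rewrite setTI; rewrite /measurable/= /row_measurable_set.
rewrite [X in measurable X](_ : _ = (@tnth _ (measurableTypeR R))^~ i @^-1` A).
  by rewrite -[X in measurable X]setTI; exact: measurable_tnth.
by apply/seteqP; split => t /=; rewrite mxE.
Qed.

Lemma measurable_tuple_of_row :
  measurable_fun [set: 'rV[R]_n] (@tuple_of_row R n).
Proof.
apply/measurable_fun_tnthP => i.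
rewrite [X in measurable_fun _ X](_ : _ = fun x : 'rV[R]_n => x ord0 i).
  exact: measurable_coord.
by apply/funext => x /=; rewrite tnth_mktuple.
Qed.

Lemma measurable_fun_row d (T : measurableType d) (f : T -> 'rV[R]_n) :
  (forall i, measurable_fun [set: T] (fun t => f t ord0 i)) ->
  measurable_fun [set: T] f.
Proof.
move=> mf; rewrite (_ : f = @row_of_tuple R n \o (@tuple_of_row R n \o f)).
  apply: measurableT_comp; first exact: measurable_row_of_tuple.
  apply/measurable_fun_tnthP => i; have := mf i.
  by congr measurable_fun; apply/funext => t /=; rewrite tnth_mktuple.
by apply/funext => t /=; rewrite tuple_of_rowK.
Qed.

Lemma measurable_row_add : measurable_fun [set: 'rV[R]_n * 'rV[R]_n]
  (fun q : 'rV[R]_n * 'rV[R]_n => q.1 + q.2).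
Proof.
apply: measurable_fun_row => i.
rewrite (_ : (fun _ => _) = (fun q : 'rV[R]_n * 'rV[R]_n => q.1 ord0 i) \+
   (fun q => q.2 ord0 i)); last by apply/funext => q; rewrite mxE.
apply: measurable_funD.
  by apply: (measurableT_comp (measurable_coord i)).
by apply: (measurableT_comp (measurable_coord i)).
Qed.

End row_measurable_theory.

Lemma measurable_row_affine (R : realType) n m (A : 'M[R]_(n, m)) (b : 'rV[R]_m) :
  measurable_fun [set: 'rV[R]_n] (fun x : 'rV[R]_n => x *m A + b).
Proof.
apply: measurable_fun_row => i.
rewrite (_ : (fun _ => _) = (fun x : 'rV[R]_n => \sum_j x ord0 j * A j i) \+
   cst (b ord0 i)); last by apply/funext => q; rewrite !mxE.
apply: measurable_funD => //; apply: measurable_sum => j.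
by apply: measurable_funM => //; exact: measurable_coord.
Qed.

Section vol_measure.
Context {R : realType} {n : nat}.

Local Notation volume := (@vol R n).

Let vol0 : volume set0 = 0%E.
Proof. by rewrite /vol (_ : [set t | _] = set0)// measure0. Qed.

Let vol_ge0 A : (0 <= volume A)%E.
Proof. exact: measure_ge0. Qed.

Let vol_sigma_additive : semi_sigma_additive volume.
Proof.
move=> F mF tF mU; rewrite /vol.
have := @measure_semi_sigma_additive _ _ _ (lebesgue_tuple R n)
  (fun k => row_of_tuple @^-1` F k) mF.
rewrite -preimage_bigcup => /(_ _ mU); apply.
apply/trivIsetP => /= i j _ _ ij; rewrite -preimage_setI.
by move/trivIsetP : tF => /(_ _ _ _ _ ij) ->//; rewrite preimage_set0.
Qed.

HB.instance Definition _ := isMeasure.Build _ _ _ volume vol0 vol_ge0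
  vol_sigma_additive.

Let vol_sigma_finite : sigma_finite setT volume.
Proof.
have [F TF Foo] := sigma_finiteT (lebesgue_tuple R n).
exists (fun k => tuple_of_row @^-1` F k).
  by rewrite -preimage_bigcup -TF preimage_setT.
move=> k; have [mF Fk] := Foo k; split.
  by rewrite -[X in measurable X]setTI; exact: measurable_tuple_of_row.
rewrite /vol (_ : [set t | _] = F k)//.
by apply/seteqP; split => t /=; have := row_of_tupleK t; rewrite /row_of_tuple => ->.
Qed.

HB.instance Definition _ := Measure_isSigmaFinite.Build _ _ _ volume
  vol_sigma_finite.

End vol_measure.

(** * Translation invariance of volume *)

Section translation.
Context {R : realType}.

(** The measure translated by a agrees with Lebesgue measure on half-open intervals, and these
    determine it. *)
Lemma lebesgue_measure_translation (a : R) (A : set (measurableTypeR R)) :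
  measurable A -> lebesgue_measure [set x : measurableTypeR R | A (x + a)] = lebesgue_measure A.
Proof.
move=> mA; pose f : measurableTypeR R -> measurableTypeR R := fun x => x + a.
have mf : measurable_fun setT f by apply: measurable_funD.
apply/esym/(@lebesgue_measure_unique _ (pushforward lebesgue_measure f)) => //.
move=> _ [[b c] _ <-]; rewrite /pushforward.
rewrite [in RHS]/= [X in _ = lebesgue_measure X](_ : _ = `]b - a, c - a]%classic); last first.
  by apply/seteqP; split => x /=; rewrite !in_itv/= ltrBlDr lerBrDr.
by rewrite /= !lebesgue_measure_itv/= !lte_fin ltrD2r -!EFinB opprB addrA subrK.
Qed.

End translation.

Section vol_translation.
Context {R : realType}.
Local Open Scope ereal_scope.

Let T := measurableTypeR R.

Let shift n (v : 'rV[R]_n) (t : n.-tuple T) : n.-tuple T :=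
  [tuple (tnth t i + v ord0 i)%R | i < n].

Let measurable_shift n (v : 'rV[R]_n) : measurable_fun setT (shift v).
Proof.
apply/measurable_fun_tnthP => i.
rewrite [X in measurable_fun _ X](_ : _ =
    (@tnth n T)^~ i \+ cst (v ord0 i))%R; last first.
  by apply/funext => t /=; rewrite tnth_mktuple.
by apply: measurable_funD => //; exact: measurable_tnth.
Qed.

(** Induction on the dimension: the shift acts separately on head and tail, so the shifted product
    measure has the right values on rectangles and is the product measure by uniqueness. *)
Let lebesgue_tuple_shift n (v : 'rV[R]_n) (A : set (n.-tuple T)) :
  measurable A -> lebesgue_tuple R n (shift v @^-1` A) = lebesgue_tuple R n A.
Proof.
elim: n v A => [|n IH] v A mA.
  rewrite (_ : shift v = id); first by rewrite preimage_id.
  by apply/funext => t; apply: eq_from_tnth => -[].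
pose v' : 'rV[R]_n := (\row_i v ord0 (lift ord0 i))%R.
pose g (q : T * n.-tuple T) : T * n.-tuple T := ((q.1 + v ord0 ord0)%R, shift v' q.2).
have mg : measurable_fun setT g.
  apply: measurable_fun_pair.
    by apply: measurable_funD => //; exact: measurable_fst.
  by apply: (measurableT_comp (measurable_shift v')).
pose c (q : T * n.-tuple T) : n.+1.-tuple T := [the n.+1.-tuple T of q.1 :: q.2].
have mc : measurable_fun setT c by exact: measurable_cons.
have mcA : measurable (c @^-1` A) by rewrite -[X in measurable X]setTI; exact: mc.
have H : (lebesgue_measure \x lebesgue_tuple R n) (c @^-1` A) =
    pushforward (lebesgue_measure \x lebesgue_tuple R n) g (c @^-1` A).
  apply: product_measure_unique => // X Y mX mY; rewrite [LHS]/= /pushforward.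
  rewrite (_ : _ @^-1` _ = [set x : T | X (x + v ord0 ord0)%R] `*` (shift v' @^-1` Y))//.
  rewrite product_measure1E.
  - by congr (_ * _); [exact: lebesgue_measure_translation|exact: IH].
  - have : measurable_fun setT (fun x : T => x + v ord0 ord0)%R by exact: measurable_funD.
    by move=> /(_ measurableT X mX); rewrite setTI.
  - by rewrite -[X in measurable X]setTI; exact: measurable_shift.
rewrite /= /cons_measure /pushforward -/c [RHS]H /pushforward.
congr (_ _); apply/seteqP; split => -[x t] /=; rewrite /c /g/=.
  by congr A; apply: eq_from_tnth => i; rewrite tnth_mktuple;
    case: (unliftP ord0 i) => [j ->|->]; rewrite ?tnthS ?tnth_mktuple ?mxE.
by congr A; apply: eq_from_tnth => i; rewrite tnth_mktuple;
  case: (unliftP ord0 i) => [j ->|->]; rewrite ?tnthS ?tnth_mktuple ?mxE.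
Qed.

Lemma vol_translation n (v : 'rV[R]_n) (A : set 'rV[R]_n) :
  measurable A -> vol [set x | A (x + v)%R] = vol A.
Proof.
move=> mA; rewrite /vol -[RHS](lebesgue_tuple_shift v)//.
congr (lebesgue_tuple R n _); apply/seteqP.
by split => t /=; congr A; apply/rowP => i; rewrite !mxE tnth_mktuple.
Qed.

End vol_translation.

(** * Uniqueness of translation-invariant measures *)

Section haar.
Context {R : realType} {n : nat}.
Local Open Scope ereal_scope.

Definition translation_invariant (mu : set 'rV[R]_n -> \bar R) : Prop :=
  forall (v : 'rV[R]_n) A, measurable A -> mu [set x | A (x + v)%R] = mu A.

Let sub_meas (S Q : set 'rV[R]_n) : measurable S -> measurable Q ->
  measurable [set q : 'rV[R]_n * 'rV[R]_n | S q.1 /\ Q (q.2 - q.1)%R].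
Proof.
move=> mS mQ.
have mf : measurable_fun setT (fun q : 'rV[R]_n * 'rV[R]_n => q.2 - q.1)%R.
  apply: measurable_fun_row => i.
  rewrite (_ : (fun _ => _) = (fun q : 'rV[R]_n * 'rV[R]_n => q.2 ord0 i)%R \-
     (fun q => q.1 ord0 i))%R; last by apply/funext => q; rewrite !mxE.
  by apply: measurable_funB; apply: (measurableT_comp (measurable_coord i)).
apply: measurableI.
  exact: (measurable_preimageT measurable_fst mS).
exact: (measurable_preimageT mf mQ).
Qed.

Let add_meas (S Q : set 'rV[R]_n) : measurable S -> measurable Q ->
  measurable [set q : 'rV[R]_n * 'rV[R]_n | Q (- q.1)%R /\ S (q.1 + q.2)%R].
Proof.
move=> mS mQ.
have mf : measurable_fun setT (fun q : 'rV[R]_n * 'rV[R]_n => - q.1)%R.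
  apply: measurable_fun_row => i.
  rewrite (_ : (fun _ => _) = \- (fun q : 'rV[R]_n * 'rV[R]_n => q.1 ord0 i)%R)%R;
    last by apply/funext => q; rewrite !mxE.
  by apply: measurable_funN; apply: (measurableT_comp (measurable_coord i)).
apply: measurableI.
  exact: (measurable_preimageT mf mQ).
exact: (measurable_preimageT measurable_row_add mS).
Qed.

(* Both sides are the product measure of a set sheared in two ways:
   [(x, y) with x in S, y - x in Q] has x-sections of constant measure, and the
   y-sections of [(z, y) with -z in Q, z + y in S] are translates of its y-sections. *)
Lemma translation_invariant_unique
    (mu nu : {sigma_finite_measure set 'rV[R]_n -> \bar R}) (S Q : set 'rV[R]_n) :
  translation_invariant mu -> translation_invariant nu ->
  measurable S -> measurable Q ->
  mu S * nu Q = mu [set x | Q (- x)%R] * nu S.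
Proof.
move=> Tmu Tnu mS mQ.
have mQN : measurable [set x : 'rV[R]_n | Q (- x)%R].
  have := measurable_preimageT (measurable_row_affine (- 1%:M)%R 0%R) mQ.
  by congr measurable; apply/seteqP; split => x /=;
    rewrite mulmxN mulmx1 addr0.
have fubini E : measurable E -> (mu \x nu) E = (mu \x^ nu) E.
  by apply: product_measure_unique => A B mA mB; exact: product_measure2E.
have <- : (mu \x nu) [set q | S q.1 /\ Q (q.2 - q.1)%R] = mu S * nu Q.
  rewrite /product_measure1 (eq_integral (fun x => (\1_S x)%:E * nu Q)); last first.
    move=> x _ /=; rewrite indicE; case: (boolP (x \in S)) => xS /=.
      rewrite mul1e -(Tnu (- x)%R _ mQ); congr (nu _).
      by apply/seteqP; split => y /=; rewrite /xsection/= inE/=; [case|split=> //; exact/set_mem].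
    rewrite mul0e (_ : xsection _ x = set0) ?measure0//.
    by apply/seteqP; split => // y; rewrite /xsection/= inE/= => -[/mem_set]; rewrite (negbTE xS).
  by rewrite ge0_integralZr ?integral_indic ?setIT//; exact: measurableT_comp.
have <- : (mu \x nu) [set q | Q (- q.1)%R /\ S (q.1 + q.2)%R] =
    mu [set x | Q (- x)%R] * nu S.
  rewrite /product_measure1
    (eq_integral (fun x => (\1_[set x | Q (- x)%R] x)%:E * nu S)); last first.
    move=> x _ /=; rewrite indicE; case: (boolP (x \in _)) => xS /=.
      rewrite mul1e -(Tnu x _ mS); congr (nu _).
      apply/seteqP; split => y /=; rewrite /xsection/= inE/= addrC; first by case.
      by split=> //; move/set_mem: xS.
    rewrite mul0e (_ : xsection _ x = set0) ?measure0//.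
    by apply/seteqP; split => // y; rewrite /xsection/= inE/= => -[Qx _]; case/negP: xS; exact/mem_set.
  by rewrite ge0_integralZr ?integral_indic ?setIT//; exact: measurableT_comp.
rewrite !fubini; [|exact: add_meas|exact: sub_meas].
rewrite /product_measure2; apply: eq_integral => y _ /=.
have mE := measurable_ysection y (sub_meas mS mQ).
rewrite -[LHS](Tmu y _ mE); congr (mu _).
apply/seteqP; split => x /=; rewrite /ysection/= !inE/= opprD addrCA subrr addr0.
  by case.
by case.
Qed.

End haar.

(** * Volume under linear maps *)

Section idempotent.

(** The identity is the sum of 1 - P, whose rows lie in the eigenspace for 0, and of P, whose rows
    lie in the eigenspace for 1; so these two eigenspaces span the whole space. *)
Lemma idempotent_diagonalizable (F : fieldType) n (P : 'M[F]_n) : P *m P = P ->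
  exists2 U, U \in unitmx & exists2 D : 'rV[F]_n,
    (forall i, D ord0 i = 0 \/ D ord0 i = 1) & P = invmx U *m diag_mx D *m U.
Proof.
move=> PP.
have /diagonalizablePeigen : exists2 rs, uniq rs &
    (\sum_(r <- rs) eigenspace P r :=: 1%:M)%MS.
  exists [:: 0; 1]; first by rewrite /= inE eq_sym oner_eq0.
  rewrite !big_cons big_nil; apply/eqmxP; rewrite submx1/= addsmx0_id.
  have -> : (1%:M : 'M[F]_n) = (1%:M - P) + P by rewrite subrK.
  apply: addmx_sub_adds; apply/eigenspaceP.
    by rewrite mulmxBl mul1mx PP subrr scale0r.
  by rewrite scale1r.
case=> U Uu /(diagonalizable_forLR Uu)[D]; rewrite mxpoly.conjVmx// => PE.
exists U => //; exists D => // i.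
(* Idempotence passes to the diagonal form, so each diagonal entry is a root of x^2 = x. *)
have : diag_mx D *m diag_mx D = diag_mx D.
  have -> : diag_mx D = U *m P *m invmx U.
    by rewrite PE !mulmxA mulmxV// mul1mx mulmxK.
  by rewrite !mulmxA mulmxKV// -(mulmxA U P P) PP.
move=> /matrixP/(_ i i); rewrite mulmx_diag !mxE eqxx mulr1n => /eqP.
rewrite -subr_eq0 -{3}[D ord0 i]mulr1 -mulrBr mulf_eq0 subr_eq0.
by case/orP => /eqP; [left|right].
Qed.

End idempotent.

Section box.
Context {R : realType} {n : nat}.
Local Open Scope ereal_scope.

Lemma vol_box (A : 'I_n -> set (measurableTypeR R)) :
  (forall i, measurable (A i)) ->
  vol [set x : 'rV[R]_n | forall i, A i (x ord0 i)] =
  \prod_(i < n) lebesgue_measure (A i).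
Proof.
move=> mA; rewrite -lebesgue_tuple_box// /vol; congr (lebesgue_tuple R n _).
by apply/seteqP; split => t /= h i; have := h i; rewrite mxE.
Qed.

Lemma measurable_box (A : 'I_n -> set (measurableTypeR R)) :
  (forall i, measurable (A i)) ->
  measurable [set x : 'rV[R]_n | forall i, A i (x ord0 i)].
Proof.
move=> mA; rewrite (_ : [set x | _] =
    \bigcap_(i in [set: 'I_n]) ((fun x : 'rV[R]_n => x ord0 i) @^-1` A i)).
  apply: fin_bigcap_measurable => // i _.
  exact: (measurable_preimageT (measurable_coord i) (mA i)).
by apply/seteqP; split => x /= xA i; [move=> _; exact: xA | exact: xA].
Qed.

Lemma measurable_mulmx (U : 'M[R]_n) (A : set 'rV[R]_n) :
  measurable A -> measurable [set x | A (x *m U)].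
Proof.
move=> mA; have := measurable_preimageT (measurable_row_affine U 0%R) mA.
by congr measurable; apply/seteqP; split => x /=; rewrite addr0.
Qed.

End box.

Section linear_preimage_measure.
Context {R : realType} {n : nat} (U : 'M[R]_n).
Hypothesis Uu : U \in unitmx.
Local Open Scope ereal_scope.

(** The proof of invertibility is an argument so that the sigma-finite structure, which rests on it,
    can be attached to this constant. *)
Definition linear_preimage_vol (Uu : U \in unitmx) (A : set 'rV[R]_n) :=
  vol [set x | A (x *m U)].

Local Notation mu := (linear_preimage_vol Uu).

Let mu0 : mu set0 = 0. Proof. exact: measure0. Qed.

Let mu_ge0 A : 0 <= mu A. Proof. exact: measure_ge0. Qed.

Let mu_sigma_additive : semi_sigma_additive mu.
Proof.
move=> F mF tF mUF; rewrite /linear_preimage_vol.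
have := @measure_semi_sigma_additive _ _ _ (@vol R n)
  (fun k => [set x | F k (x *m U)]).
apply.
- by move=> k; exact: measurable_mulmx.
- apply/trivIsetP => /= i j _ _ ij; apply/seteqP; split => // x -[Fi Fj].
  by move/trivIsetP : tF => /(_ _ _ I I ij) /seteqP[/(_ (x *m U)) + _]; apply.
- exact: measurable_mulmx mUF.
Qed.

HB.instance Definition _ := isMeasure.Build _ _ _ mu mu0 mu_ge0 mu_sigma_additive.

Let mu_sigma_finite : sigma_finite setT mu.
Proof.
have [F TF Foo] := sigma_finiteT (@vol R n).
exists (fun k => [set x | F k (x *m invmx U)]).
  apply/seteqP; split => // x _.
  have [k _ Fk] : (\bigcup_k F k) (x *m invmx U) by rewrite -TF.
  by exists k.
move=> k; have [mF Fk] := Foo k; split; first exact: measurable_mulmx.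
rewrite /linear_preimage_vol (_ : [set x | _] = F k)//.
by apply/seteqP; split => x /=; rewrite mulmxK.
Qed.

HB.instance Definition _ := Measure_isSigmaFinite.Build _ _ _ mu mu_sigma_finite.

Lemma linear_preimage_vol_translation : translation_invariant mu.
Proof.
move=> v A mA; rewrite /linear_preimage_vol.
rewrite -[RHS](vol_translation (v *m invmx U)); last exact: measurable_mulmx.
by congr (vol _); apply/seteqP; split => x /=; rewrite mulmxDl mulmxKV.
Qed.

End linear_preimage_measure.

Section vol_linear.
Context {R : realType} {n : nat}.
Local Open Scope ereal_scope.

Let cube : set 'rV[R]_n := [set x | forall i, `[0%R, 1%R]%classic (x ord0 i)].

Let mcube : measurable cube.
Proof. by apply: (@measurable_box _ _ (fun=> `[0%R, 1%R]%classic)) => i; exact: measurable_itv. Qed.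

Let vol_cube : vol cube = 1.
Proof.
rewrite /cube (@vol_box _ _ (fun=> `[0%R, 1%R]%classic)); last by move=> i; exact: measurable_itv.
by rewrite big1// => i _; rewrite lebesgue_measure_itv/= lte_fin ltr01 -EFinB subr0.
Qed.


(** The volume of the preimage is a translation-invariant measure, hence a multiple of [vol]; taking
    the unit cube, of volume 1, as the set Q of the uniqueness lemma gives the factor. *)
Lemma vol_linear (U : 'M[R]_n) : U \in unitmx -> exists c : \bar R,
  forall A, measurable A -> vol [set x | A (x *m U)] = c * vol A.
Proof.
move=> Uu; exists (linear_preimage_vol Uu [set x | cube (- x)%R]) => A mA.
rewrite -[LHS]mule1 -vol_cube.
apply: (@translation_invariant_unique R n (linear_preimage_vol Uu) (@vol R n)) => //.
  exact: linear_preimage_vol_translation.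
by move=> v B mB; exact: vol_translation.
Qed.

(** The factor from [vol_linear] is evaluated on the unit cube, whose preimage is a box with sides
    [(D ord0 i)^-1]. *)
Lemma vol_diag (D : 'rV[R]_n) (A : set 'rV[R]_n) :
  (forall i, 0 < D ord0 i)%R -> measurable A ->
  vol A = (\prod_(i < n) D ord0 i)%:E * vol [set x | A (x *m diag_mx D)].
Proof.
move=> D0 mA.
have Du : diag_mx D \in unitmx.
  rewrite unitmxE det_diag unitfE; apply/prodf_neq0 => i _.
  by rewrite gt_eqF.
have [c cE] := vol_linear Du.
suff cD : c = (\prod_(i < n) (D ord0 i)^-1)%:E.
  rewrite cE// cD muleA -EFinM -big_split/= big1 ?mul1e// => i _.
  by rewrite mulfV// gt_eqF.
have := cE _ mcube; rewrite vol_cube mule1 => <-.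
rewrite (_ : [set x | _] = [set x : 'rV[R]_n |
    forall i, `[0%R, (D ord0 i)^-1%R]%classic (x ord0 i)]); last first.
  have DE (x : 'rV[R]_n) i :
      (x ord0 i \in `[0%R, (D ord0 i)^-1%R]) = ((x *m diag_mx D) ord0 i \in `[0%R, 1%R]).
    rewrite !in_itv/= mul_mx_diag mxE -[((D ord0 i)^-1)%R]mul1r.
    by rewrite ler_pdivlMr// pmulr_lge0.
  by apply/seteqP; split => x /= h i; have := h i; rewrite /= DE.
rewrite (@vol_box _ _ (fun i => `[0%R, (D ord0 i)^-1%R]%classic)); last first.
  by move=> i; exact: measurable_itv.
rewrite -prodEFin; apply: eq_bigr => i _.
by rewrite lebesgue_measure_itv/= lte_fin invr_gt0 D0 oppr0 adde0.
Qed.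

(** In coordinates that diagonalize P, the map is diagonal with entries 1 and s, and m, the
    dimension of the kernel of P, counts the entries s. The extreme values of m are recorded because
    they later single out the vertices (m = n) and the faces whose only normal is 0 (m = 0). *)
Lemma vol_idempotent_scale (P : 'M[R]_n) : P *m P = P ->
  exists m, [/\ (m <= n)%N, m = n -> P = 0%R, m = 0%N -> P = 1%:M%R &
  forall s A, (0 < s)%R -> measurable A ->
    vol A = (s ^+ m)%:E * vol [set x | A (x *m (P + s *: (1%:M - P)))]].
Proof.
move=> /idempotent_diagonalizable[U Uu [D D01 PE]].
have [c cE] := vol_linear Uu.
have Uiu : invmx U \in unitmx by rewrite unitmx_inv.
have [c' c'E] := vol_linear Uiu.
(* The factors of the two inverse changes of basis cancel, as the cube shows. *)
have cc' : c' * c = 1.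
  rewrite -[LHS]mule1 -vol_cube -muleA -cE// -c'E; last exact: measurable_mulmx.
  by congr (vol _); apply/seteqP; split => x /=; rewrite mulmxKV.
exists #|[set i | D ord0 i == 0%R]%SET|; split.
- by have := max_card (mem [set i | D ord0 i == 0%R]%SET); rewrite card_ord.
- move=> cardn; rewrite PE; suff -> : D = 0%R by rewrite (raddf0 (@diag_mx _ _)) mulmx0 mul0mx.
  apply/rowP => i; rewrite mxE; apply/eqP.
  have : i \in [set i | D ord0 i == 0%R]%SET.
    suff -> : [set i | D ord0 i == 0%R]%SET = [set: 'I_n]%SET by rewrite inE.
    by apply/eqP; rewrite eqEcard finset.subsetT cardsT card_ord cardn leqnn.
  by rewrite inE.
- move=> /eqP; rewrite cards_eq0 => /eqP D0.
  rewrite PE; suff -> : D = const_mx 1%R by rewrite diag_const_mx mulmx1 mulVmx.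
  apply/rowP => i; rewrite mxE; case: (D01 i) => // Di0.
  have : i \in [set i | D ord0 i == 0%R]%SET by rewrite inE Di0.
  by rewrite D0 inE.
move=> s A s0 mA.
pose Ds := (\row_i (D ord0 i + s * (1 - D ord0 i)))%R.
have -> : (P + s *: (1%:M - P) = invmx U *m diag_mx Ds *m U)%R.
  have -> : (diag_mx Ds = diag_mx D + s *: (1%:M - diag_mx D))%R.
    apply/matrixP => i j; rewrite !mxE; case: eqVneq => [->|] /=.
      by rewrite !mulr1n.
    by rewrite !mulr0n oppr0 addr0 mulr0 addr0.
  rewrite mulmxDr mulmxDl -PE -scalemxAr -scalemxAl mulmxBr mulmxBl -PE.
  by rewrite mulmx1 mulVmx.
have Dsi i : Ds ord0 i = if D ord0 i == 0%R then s else 1%R.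
  rewrite mxE; case: (D01 i) => ->; first by rewrite eqxx add0r subr0 mulr1.
  by rewrite oner_eq0 subrr mulr0 addr0.
have Ds0 i : (0 < Ds ord0 i)%R by rewrite Dsi; case: ifP.
have prodDs : (\prod_(i < n) Ds ord0 i = s ^+ #|[set i | D ord0 i == 0%R]%SET|)%R.
  rewrite (eq_bigr _ (fun i _ => Dsi i)) -big_mkcond/= prodr_const.
  by congr (_ ^+ _)%R; apply: eq_card => i; rewrite !inE.
rewrite -[vol A]mul1e -cc' -muleA -cE//.
rewrite (vol_diag Ds0) ?prodDs; last exact: measurable_mulmx.
rewrite muleCA; congr (_ * _).
rewrite -c'E; last by do 2 apply: measurable_mulmx.
by congr (vol _); apply/seteqP; split => x /=; rewrite !mulmxA.
Qed.

End vol_linear.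

(** * Euclidean geometry *)

Section euclidean.
Context {R : realType} {d : nat}.
Implicit Types x y z u v : 'rV[R]_d.

Definition dot x y : R := \sum_i x ord0 i * y ord0 i.

Lemma dotC x y : dot x y = dot y x.
Proof. by apply: eq_bigr => i _; rewrite mulrC. Qed.

Lemma dotDl x y z : dot (x + y) z = dot x z + dot y z.
Proof. by rewrite -big_split; apply: eq_bigr => i _; rewrite mxE mulrDl. Qed.

Lemma dotNl x z : dot (- x) z = - dot x z.
Proof. by rewrite -sumrN; apply: eq_bigr => i _; rewrite mxE mulNr. Qed.

Lemma dotZl (a : R) x z : dot (a *: x) z = a * dot x z.
Proof. by rewrite mulr_sumr; apply: eq_bigr => i _; rewrite mxE mulrA. Qed.

Lemma dotBl x y z : dot (x - y) z = dot x z - dot y z.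
Proof. by rewrite dotDl dotNl. Qed.

Lemma dotDr x y z : dot z (x + y) = dot z x + dot z y.
Proof. by rewrite !(dotC z) dotDl. Qed.

Lemma dotNr x z : dot z (- x) = - dot z x.
Proof. by rewrite !(dotC z) dotNl. Qed.

Lemma dotBr x y z : dot z (x - y) = dot z x - dot z y.
Proof. by rewrite !(dotC z) dotBl. Qed.

Lemma dotZr (a : R) x z : dot z (a *: x) = a * dot z x.
Proof. by rewrite !(dotC z) dotZl. Qed.

Lemma dot0l x : dot 0 x = 0.
Proof. by rewrite -(scale0r 0) dotZl mul0r. Qed.

Lemma dot_suml (I : finType) (F : I -> 'rV[R]_d) z :
  dot (\sum_i F i) z = \sum_i dot (F i) z.
Proof. by apply: (big_morph (dot^~ z)) => [x y|]; rewrite ?dotDl ?dot0l. Qed.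

Lemma dot_ge0 x : 0 <= dot x x.
Proof. by apply: sumr_ge0 => i _; rewrite -expr2 sqr_ge0. Qed.

Lemma dot_eq0 x : dot x x = 0 -> x = 0.
Proof.
move=> /eqP; rewrite psumr_eq0 => [/allP x0|i _]; last by rewrite -expr2 sqr_ge0.
apply/rowP => i; have := x0 i; rewrite mem_index_enum mxE => /(_ isT).
by rewrite mulf_eq0 orbb => /eqP.
Qed.

Lemma enormE x : enorm x = Num.sqrt (dot x x).
Proof. by rewrite /enorm; congr Num.sqrt; apply: eq_bigr => i _; rewrite expr2. Qed.

Lemma enorm_le x (r : R) : 0 <= r -> (enorm x <= r) = (dot x x <= r ^+ 2).
Proof.
move=> r0; rewrite enormE -[X in _ <= X](ger0_norm r0) -sqrtr_sqr ler_sqrt//.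
by rewrite sqr_ge0.
Qed.

Lemma enorm_ge0 x : 0 <= enorm x.
Proof. exact: sqrtr_ge0. Qed.

Lemma coord_le_enorm x i : `|x ord0 i| <= enorm x.
Proof.
rewrite enormE -sqrtr_sqr ler_sqrt ?dot_ge0// /dot (bigD1 i)//= -expr2.
by rewrite lerDl; apply: sumr_ge0 => j _; rewrite -expr2 sqr_ge0.
Qed.

Lemma enormZ (a : R) x : 0 <= a -> enorm (a *: x) = a * enorm x.
Proof.
move=> a0; rewrite !enormE dotZl dotZr mulrA -expr2 sqrtrM ?sqr_ge0// sqrtr_sqr.
by rewrite ger0_norm.
Qed.

(** P projects onto the row space of B along its orthogonal complement, the kernel of [B^T]; these
    meet only in 0 because a vector in both is orthogonal to itself. *)
Lemma orthogonal_projection m (B : 'M[R]_(m, d)) : exists P : 'M[R]_d,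
  [/\ P *m P = P, forall x, (x <= B)%MS -> x *m P = x &
      forall u, (forall i, dot (row i B) u = 0) -> u *m P = 0].
Proof.
have BT u : u *m B^T = \row_i dot (row i B) u.
  by apply/rowP => i; rewrite !mxE; apply: eq_bigr => j _; rewrite !mxE mulrC.
have cap0 : (<<B>> :&: kermx B^T = 0)%MS.
  apply/eqP; rewrite -submx0; apply/rV_subP => x.
  rewrite sub_capmx genmxE => /andP[/submxP[y xE] /sub_kermxP xB].
  rewrite submx0; apply/eqP/dot_eq0.
  transitivity ((x *m x^T) ord0 ord0); first by rewrite mxE; apply: eq_bigr => i _; rewrite !mxE.
  by rewrite {2}xE trmx_mul mulmxA xB mul0mx mxE.
exists (proj_mx <<B>>%MS (kermx B^T)); split.
- exact: proj_mx_proj.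
- by move=> x xB; rewrite proj_mx_id// genmxE.
- move=> u uB; rewrite proj_mx_0//; apply/sub_kermxP; rewrite BT.
  by apply/rowP => i; rewrite !mxE uB.
Qed.

Lemma measurable_dot dT (X : measurableType dT) (f : X -> 'rV[R]_d) u :
  measurable_fun [set: X] f -> measurable_fun [set: X] (fun t => dot (f t) u).
Proof.
move=> mf; apply: measurable_sum => i; apply: measurable_funM => //.
exact: (measurableT_comp (measurable_coord i) mf).
Qed.

End euclidean.

Lemma cvg_sumR (R : realType) (T : Type) (F : set_system T) {FF : Filter F}
    (I : Type) (s : seq I) (f : I -> T -> R) (l : I -> R) :
  (forall i, f i x @[x --> F] --> l i) ->
  \sum_(i <- s) f i x @[x --> F] --> \sum_(i <- s) l i.
Proof.
move=> fl; elim: s => [|i s IH].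
  by rewrite big_nil; under eq_fun do rewrite big_nil; exact: cvg_cst.
rewrite big_cons; under eq_fun do rewrite big_cons.
by apply: cvgD; [exact: fl|exact: IH].
Qed.

(** * Convex hulls and nearest points *)

Section hull.
Context {R : realType} {N d : nat} (p : 'I_N -> 'rV[R]_d).
Implicit Types (I J : {set 'I_N}) (l : 'I_N -> R) (x y q u : 'rV[R]_d).

Definition convex_weights J l : Prop :=
  [/\ forall i, 0 <= l i, forall i, i \notin J -> l i = 0 & \sum_i l i = 1].

(** [convex_set] speaks of two points at a time. Partial sums are therefore normalized by their
    total weight, and each further point enters by a binary combination; a total weight of 0 is kept
    as a separate case. *)
Lemma convex_set_combination (A : set 'rV[R]_d) J l :
  @convex_set R 'rV[R]_d A -> (forall i, i \in J -> A (p i)) ->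
  convex_weights J l -> A (\sum_i l i *: p i).
Proof.
move=> cA Ap [l0 lJ l1].
have key (s : seq 'I_N) : let S := \sum_(i <- s) l i in
    (S = 0 /\ \sum_(i <- s) l i *: p i = 0) \/
    (0 < S /\ A (S^-1 *: \sum_(i <- s) l i *: p i)).
  elim: s => [|i s IH] /=; first by left; rewrite !big_nil.
  rewrite !big_cons; set S := \sum_(j <- s) l j in IH *.
  set v := \sum_(j <- s) l j *: p j in IH *.
  have [li0|li0] := eqVneq (l i) 0.
    by rewrite li0 scale0r !add0r; exact: IH.
  have li_gt0 : 0 < l i by rewrite lt0r li0 l0.
  have iJ : i \in J by apply/negPn/negP => /lJ /eqP; rewrite (negbTE li0).
  right; case: IH => [[-> ->]|[S0 Av]].
    by rewrite !addr0 scalerA mulVf// scale1r; split => //; exact: Ap.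
  have liS : 0 < l i + S by rewrite addr_gt0.
  split => //.
  have t0 : 0 <= l i / (l i + S) by rewrite divr_ge0// ltW.
  have t1 : l i / (l i + S) <= 1 by rewrite ler_pdivrMr// mul1r lerDl ltW.
  have /set_mem := cA (p i) (S^-1 *: v) (Itv01 t0 t1) (mem_set (Ap _ iJ)) (mem_set Av).
  have n1 : l i + S != 0 by rewrite gt_eqF.
  have E : (1 - l i / (l i + S)) * S^-1 = (l i + S)^-1.
    apply: (mulfI n1); rewrite mulrA mulrBr mulr1 mulrCA mulfV// mulr1.
    by rewrite addrAC subrr add0r !mulfV// gt_eqF.
  congr (A _); rewrite /conv/= scalerDr !scalerA; congr (_ *: _ + _ *: _).
    by rewrite mulrC.
  exact: E.
have := key (index_enum 'I_N); rewrite /= l1 invr1 scale1r.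
by case=> [[/eqP]|[]//]; rewrite oner_eq0.
Qed.

(** The combinations form a convex set that contains the points, so it contains the smallest such
    set; the converse is [convex_set_combination]. *)
Lemma hullIP J x :
  hullI p J x <-> exists2 l, convex_weights J l & x = \sum_i l i *: p i.
Proof.
split; last first.
  move=> [l wl ->] A [cA Ap]; apply: (convex_set_combination cA _ wl) => i iJ.
  by apply: Ap; exists i.
move: x; apply: smallest_sub.
  move=> x y t /set_mem[l [l0 lJ l1] ->] /set_mem[m [m0 mJ m1] ->]; apply/mem_set.
  exists (fun i => t%:num * l i + (1 - t%:num) * m i).
    split => [i|i iJ|].
    - by rewrite addr_ge0// mulr_ge0// subr_ge0.
    - by rewrite lJ// mJ// !mulr0 addr0.
    - by rewrite big_split/= -!mulr_sumr l1 m1 !mulr1 addrC subrK.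
  rewrite /conv/= !scaler_sumr -big_split; apply: eq_bigr => i _.
  by rewrite [RHS]scalerDl -!scalerA.
move=> _ [i iJ <-]; exists (fun j => (j == i)%:R).
  split => [j|j jJ|]; first exact: ler0n.
    by case: eqVneq => // ji; move: jJ; rewrite ji iJ.
  by rewrite (bigD1 i)//= eqxx big1 ?addr0// => j /negbTE ->.
rewrite (bigD1 i)//= eqxx scale1r big1 ?addr0// => j /negbTE ->.
by rewrite scale0r.
Qed.

Lemma hullI_point J i : i \in J -> hullI p J (p i).
Proof. by move=> iJ; apply: sub_gen_smallest; exists i. Qed.

Lemma hullI_sub I J : {subset J <= I} -> hullI p J `<=` hullI p I.
Proof.
move=> JI x /hullIP[l [l0 lJ l1] ->]; apply/hullIP; exists l => //; split => // i iI.
by apply: lJ; apply: contra iI; exact: JI.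
Qed.

Lemma hullI_neq0 J x : hullI p J x -> exists i, i \in J.
Proof.
move=> /hullIP[l [_ lJ l1] _]; have [J0|[i iJ]] := set_0Vmem J; last by exists i.
move: l1; rewrite big1 => [/esym/eqP|i _]; first by rewrite oner_eq0.
by rewrite lJ// J0 inE.
Qed.

Lemma dot_hullI_le J q u (c : R) : hullI p J q ->
  (forall i, i \in J -> dot (p i) u <= c) -> dot q u <= c.
Proof.
move=> /hullIP[l [l0 lJ l1] ->] h; rewrite dot_suml -[c]mul1r -l1 mulr_suml.
apply: ler_sum => i _; rewrite dotZl; have [iJ|iJ] := boolP (i \in J).
  by rewrite ler_wpM2l// h.
by rewrite lJ// !mul0r.
Qed.

Lemma dot_hullI_eq J q u (c : R) : hullI p J q ->
  (forall i, i \in J -> dot (p i) u = c) -> dot q u = c.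
Proof.
move=> qJ h; apply/eqP; rewrite eq_le (dot_hullI_le qJ) => [|i /h ->//].
rewrite -lerN2 -dotNr (dot_hullI_le qJ)// => i iJ.
by rewrite dotNr h.
Qed.

Lemma hullI_coord_le J q c : hullI p J q -> `|q ord0 c| <= \sum_i `|p i ord0 c|.
Proof.
move=> /hullIP[l [l0 lJ l1] ->]; rewrite summxE (le_trans (ler_norm_sum _ _ _))//.
apply: ler_sum => i _; rewrite mxE normrM ger0_norm// ler_piMl//.
by rewrite -l1 (bigD1 i)//= lerDl sumr_ge0.
Qed.

Lemma hullI_segment J q i (t : R) : i \in J -> hullI p J q -> 0 <= t <= 1 ->
  hullI p J (q + t *: (p i - q)).
Proof.
move=> iJ /hullIP[l [l0 lJ l1] ->] /andP[t0 t1]; apply/hullIP.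
exists (fun j => (1 - t) * l j + t * (j == i)%:R).
  split => [j|j jJ|].
  - by rewrite addr_ge0// mulr_ge0// subr_ge0.
  - rewrite lJ// mulr0 add0r; case: eqVneq => [ji|]; rewrite ?mulr0//.
    by move: jJ; rewrite ji iJ.
  - rewrite big_split/= -!mulr_sumr l1 mulr1 (bigD1 i)//= eqxx big1.
      by rewrite addr0 mulr1 subrK.
    by move=> j /negbTE ->.
under [in RHS]eq_bigr do rewrite scalerDl -!scalerA.
rewrite big_split/= -!scaler_sumr [X in _ = _ + _ *: X](bigD1 i)//= eqxx scale1r.
rewrite [X in _ = _ + _ *: (_ + X)]big1 => [|j /negbTE ->]; last by rewrite scale0r.
by rewrite addr0 scalerBl scale1r scalerBr addrCA addrC.
Qed.

Lemma compact_convex_weights J :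
  compact [set w : 'rV[R]_N | convex_weights J (fun i => w ord0 i)].
Proof.
(* The segment is [0, 1] for i in J and [0, 0] otherwise, which makes the weights vanish off J. *)
pose S i : set R := `[0, (i \in J)%:R]%classic.
rewrite (_ : [set w | _] =
    [set w : 'rV[R]_N | forall i, S i (w ord0 i)] `&`
    [set w : 'rV[R]_N | \sum_i w ord0 i = 1]).
  apply: compact_closedI.
    by apply: (@rV_compact R N S) => i; exact: segment_compact.
  have -> : [set w : 'rV[R]_N | \sum_i w ord0 i = 1] =
      (fun w : 'rV[R]_N => \sum_i w ord0 i) @^-1` [set 1] by [].
  apply: closed_comp => [w _|]; last exact/accessible_closed_set1/hausdorff_accessible/Rhausdorff.
  have := @cvg_sumR R _ (nbhs w) (nbhs_filter w) _ (index_enum 'I_N)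
    (fun i (v : 'rV[R]_N) => v ord0 i) (fun i => w ord0 i).
  by apply=> i; exact: coord_continuous.
apply/seteqP; split => w /=.
  move=> [w0 wJ w1]; split => // i; rewrite /S/= in_itv/= w0/=.
  have [iJ|/wJ ->//] := boolP (i \in J).
  by rewrite -w1 (bigD1 i)//= lerDl sumr_ge0.
move=> [wS w1]; split => // i; have := wS i; rewrite /S/= in_itv/=.
  by case/andP.
by move=> /[swap] /negbTE -> /andP[? ?]; apply/eqP; rewrite eq_le; apply/andP.
Qed.

Lemma nearest_point J x : J != finset.set0 ->
  exists2 q, hullI p J q & forall i, i \in J -> dot (p i - q) (x - q) <= 0.
Proof.
move=> /set0Pn[i0 i0J].
pose comb (w : 'rV[R]_N) := \sum_i w ord0 i *: p i.
pose f (w : 'rV[R]_N) := dot (x - comb w) (x - comb w).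
have [] := @EVT_min_rV R N f _ _ (@compact_convex_weights J).
- have /hullIP[l wl _] := hullI_point i0J; exists (\row_i l i) => /=.
  by move: wl; congr convex_weights; apply/funext => i; rewrite mxE.
- apply: continuous_subspaceT => w.
  have := @cvg_sumR R _ (nbhs w) (nbhs_filter w) _ (index_enum 'I_d)
    (fun c v => (x - comb v) ord0 c * (x - comb v) ord0 c)
    (fun c => (x - comb w) ord0 c * (x - comb w) ord0 c).
  apply=> c.
  have cc : (fun w : 'rV[R]_N => (x - comb w) ord0 c) @ w --> (x - comb w) ord0 c.
    rewrite (_ : (fun w : 'rV[R]_N => (x - comb w) ord0 c) =
       (fun w : 'rV[R]_N => x ord0 c - \sum_i w ord0 i * p i ord0 c)); last first.
      by apply/funext => v; rewrite !mxE summxE; under eq_bigr do rewrite mxE.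
    rewrite (_ : (x - comb w) ord0 c = x ord0 c - \sum_i w ord0 i * p i ord0 c); last first.
      by rewrite !mxE summxE; under eq_bigr do rewrite mxE.
    have := @cvg_sumR R _ (nbhs w) (nbhs_filter w) _ (index_enum 'I_N)
      (fun i (v : 'rV[R]_N) => v ord0 i * p i ord0 c) (fun i => w ord0 i * p i ord0 c).
    have cP i : (fun v : 'rV[R]_N => v ord0 i * p i ord0 c) @ (nbhs w) --> w ord0 i * p i ord0 c.
      exact: (@cvgMr_tmp R _ _ (nbhs_filter w) _ _ _ (@coord_continuous R 1 N ord0 i w)).
    by move=> /(_ cP) sP; exact: (cvgB (cvg_cst (x ord0 c)) sP).
  exact: (cvgM cc cc).
move=> w /set_mem/= ww wmin.
exists (comb w); first by apply/hullIP; exists (fun i => w ord0 i).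
move=> i iJ; set q := comb w.
have qJ : hullI p J q by apply/hullIP; exists (fun i => w ord0 i).
rewrite leNgt; apply/negP => c0; set c := dot _ _ in c0.
set b := dot (p i - q) (p i - q).
have b0 : 0 <= b by exact: dot_ge0.
have key t : 0 <= t <= 1 -> 2 * t * c <= t ^+ 2 * b.
  move=> t01; have /hullIP[l wl lE] := hullI_segment iJ qJ t01.
  have /(_ _)/wrap[] := wmin (\row_i l i).
    apply/mem_set => /=; move: wl; congr convex_weights.
    by apply/funext => j; rewrite mxE.
  rewrite /f (_ : comb (\row_i l i) = q + t *: (p i - q)); last first.
    by rewrite lE; apply: eq_bigr => j _; rewrite mxE.
  rewrite -/q opprD addrA.
  have -> : dot (x - q - t *: (p i - q)) (x - q - t *: (p i - q)) =
      dot (x - q) (x - q) - 2 * t * c + t ^+ 2 * b.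
    rewrite dotBl !(dotBr _ (t *: _)) !dotZl !dotZr -/b -/c.
    by rewrite (dotC (x - q) (p i - q)) -/c; lra.
  by move=> H; lra.
have bc : 0 < b + c by rewrite ltr_wpDl.
(* At t = c / (b + c) one has t^2 b = t c - t^2 c < 2 t c, against [key]. The summand c in the
   denominator keeps t at most 1 and covers b = 0. *)
have t0 : 0 < c / (b + c) by rewrite divr_gt0.
have t1 : c / (b + c) <= 1 by rewrite ler_pdivrMr ?mul1r ?lerDr.
have /key : 0 <= c / (b + c) <= 1 by rewrite t1 ltW.
have : c / (b + c) * (b + c) = c by rewrite divfK// gt_eqF.
move: t0; set t := c / (b + c) => t0 tE; apply/negP; rewrite -ltNge.
have tb : t * b = c - t * c by lra.
have -> : t ^+ 2 * b = t * c - t * t * c by rewrite expr2 -mulrA tb; lra.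
have : 0 < t * c by exact: mulr_gt0.
have : 0 < t * t * c by apply: mulr_gt0 => //; apply: mulr_gt0.
by move=> ? ?; lra.
Qed.

End hull.

(** * Measurability of convex hulls *)

Section measurable_hull.
Context {R : realType} {d : nat}.

Lemma measurable_dot_le (u : 'rV[R]_d) (c : R) : measurable [set x : 'rV[R]_d | dot x u <= c].
Proof.
rewrite (_ : [set x | _] = (fun x : 'rV[R]_d => dot x u) @^-1` `]-oo, c]%classic).
  apply: measurable_preimageT; last exact: measurable_itv.
  by apply: measurable_dot; exact: measurable_id.
by apply/seteqP; split => x /=; rewrite in_itv.
Qed.

Lemma rational_approximation (v : 'rV[R]_d) (e : R) : 0 < e ->
  exists w : 'rV[rat]_d, forall i, `|v ord0 i - ratr (w ord0 i)| < e.
Proof.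
move=> e0; have h i : exists q : rat, `|v ord0 i - ratr q| < e.
  have [q] : exists q : rat, ratr q \in `]v ord0 i - e, v ord0 i + e[.
    by apply: rat_in_itvoo; rewrite ltrBlDr -addrA ltrDl addr_gt0.
  by rewrite in_itv/= => /andP[? ?]; exists q; rewrite distrC ltr_distl; apply/andP.
have [f fE] := choice h.
by exists (\row_i f i) => i; rewrite mxE.
Qed.

Context {N : nat} (p : 'I_N -> 'rV[R]_d).

(* The complement of the hull is the union of the rational open half-spaces that miss it. *)
Lemma measurable_hullI (J : {set 'I_N}) : measurable (hullI p J).
Proof.
have [->|J0] := eqVneq J finset.set0.
  rewrite (_ : hullI p _ = set0) ?measurable0//.
  by apply/seteqP; split => // x /hullI_neq0[i]; rewrite inE.
pose rv (w : 'rV[rat]_d) : 'rV[R]_d := map_mx ratr w.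
pose F w := \bigcap_(j in [set` J]) ~` [set x : 'rV[R]_d | dot x (rv w) <= dot (p j) (rv w)].
rewrite -[hullI p J]setCK (_ : ~` hullI p J = \bigcup_w F w).
  apply: measurableC; apply: countable_bigcupT_measurable; first exact: countableP.
  move=> w; apply: fin_bigcap_measurable => [|j _]; first exact: finite_finset.
  by apply: measurableC; exact: measurable_dot_le.
apply/seteqP; split => x; last first.
  move=> [w _ Fx] xJ; have [j0 j0J] := set0Pn _ J0.
  pose j := [arg max_(j > j0 in J) dot (p j) (rv w)]%O.
  have [jJ jmax] : j \in J /\ forall k, k \in J -> dot (p k) (rv w) <= dot (p j) (rv w).
    by rewrite /j; case: arg_maxP => // k kJ kmax; split.
  by apply: (Fx j jJ) => /=; exact: dot_hullI_le jmax.
move=> xJ; have [q qJ qx] := nearest_point p x J0.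
have v0 : 0 < dot (x - q) (x - q).
  rewrite lt0r dot_ge0 andbT; apply/eqP => /dot_eq0/eqP; rewrite subr_eq0 => /eqP xq.
  by apply: xJ; rewrite xq.
(* C bounds the sum of the absolute coordinates of every x - p j. A coordinate error below |x - q|^2
   / (C + 1) in the direction x - q then changes the product with x - p j by less than |x - q|^2,
   while that product is at least |x - q|^2 for j in J. *)
pose C := \sum_(j : 'I_N) \sum_i `|(x - p j) ord0 i|.
have C0 : 0 <= C by do 2 apply: sumr_ge0 => ? _.
have [w wE] := rational_approximation (x - q) (divr_gt0 v0 (ltr_wpDl C0 ltr01)).
exists w => // j jJ /=; apply/negP; rewrite -ltNge -subr_gt0 -dotBl.
rewrite -[rv w](subKr (x - q)) dotBr subr_gt0.
have step1 : dot (x - p j) (x - q - rv w) <= C * (dot (x - q) (x - q) / (C + 1)).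
  rewrite /C [X in _ <= X * _](bigD1 j)//= mulrDl -[X in X <= _]addr0 lerD//.
    rewrite mulr_suml; apply: ler_sum => i _.
    rewrite (le_trans (ler_norm _))// normrM ler_wpM2l//.
    by have := wE i; rewrite !mxE => /ltW.
  rewrite mulr_ge0//; first by do 2 apply: sumr_ge0 => ? _.
  by rewrite divr_ge0 ?addr_ge0// ltW.
apply: (le_lt_trans step1).
have step2 : dot (x - q) (x - q) <= dot (x - p j) (x - q).
  by have := qx j jJ; rewrite !dotBl; lra.
apply: (lt_le_trans _ step2).
rewrite mulrA ltr_pdivrMr ?ltr_wpDl// mulrC ltr_pM2l//.
by rewrite ltrDl.
Qed.

End measurable_hull.

(** * Normal decomposition of parallel bodies *)

Section piece.
Context {R : realType} {N d : nat} (p : 'I_N -> 'rV[R]_d).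
Implicit Types (I J : {set 'I_N}) (q u x y : 'rV[R]_d) (r s : R).

Definition face I u : {set 'I_N} :=
  [set j in I | [forall k in I, dot (p k) u <= dot (p j) u]]%SET.

Lemma faceP I u j : reflect (j \in I /\ forall k, k \in I -> dot (p k) u <= dot (p j) u)
  (j \in face I u).
Proof.
rewrite inE; apply: (iffP andP) => -[jI h]; split => //.
  by move=> k kI; exact: (implyP (forallP h k)).
by apply/forallP => k; apply/implyP => kI; exact: h.
Qed.

Lemma face_eq I u j k : j \in face I u -> k \in face I u -> dot (p j) u = dot (p k) u.
Proof.
move=> /faceP[jI hj] /faceP[kI hk]; apply/eqP.
by rewrite eq_le hj// hk.
Qed.

Lemma faceZ I u s : 0 < s -> face I (s *: u) = face I u.
Proof.
move=> s0; apply/setP => j; rewrite !inE; congr (_ && _).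
by apply: eq_forallb => k; rewrite !dotZr ler_pM2l.
Qed.

Lemma measurable_face I J : measurable [set u | face I u = J].
Proof.
pose S j := [set u | j \in face I u].
have mS j : measurable (S j).
  rewrite (_ : S j = if j \in I then \bigcap_(k in [set` I])
      [set u : 'rV[R]_d | dot u (p k - p j) <= 0] else set0).
    case: ifP => // _; apply: fin_bigcap_measurable => [|k _]; first exact: finite_finset.
    exact: measurable_dot_le.
  apply/seteqP; split => u; rewrite /S/=.
    by move=> /faceP[-> h] k /= kI; rewrite dotC dotBl subr_le0 h.
  case: ifP => // jI h; apply/faceP; split => // k kI.
  by have := h k kI; rewrite /= dotC dotBl subr_le0.
rewrite (_ : [set u | _] = \bigcap_(j in [set: 'I_N]) if j \in J then S j else ~` S j).
  apply: fin_bigcap_measurable => // j _; case: ifP => _ //; exact: measurableC.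
apply/seteqP; split => u /=.
  by move=> uJ j _; rewrite -uJ; case: ifPn => [//|/negP].
move=> h; apply/setP => j; have := h j Logic.I; rewrite /S/=.
by case: ifP => _; [move=> ->|move/negP/negbTE].
Qed.

(* For x in the piece, q is the point of the hull of the p_i, i in I, nearest to x,
   and u is an outer normal exposing exactly the p_j, j in J, among them. *)
Definition piece I J r : set 'rV[R]_d :=
  [set x | exists q u, [/\ x = q + u, hullI p J q, face I u = J & enorm u <= r]].

Lemma piece_orthogonal I J q u j : hullI p J q -> face I u = J -> j \in J ->
  dot (q - p j) u = 0.
Proof.
move=> qJ uJ jJ; rewrite dotBl; apply/eqP; rewrite subr_eq0; apply/eqP.
by apply: (dot_hullI_eq qJ) => i iJ; apply: (@face_eq I); rewrite uJ.
Qed.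

Lemma piece_le I J r s : r <= s -> piece I J r `<=` piece I J s.
Proof. by move=> rs x [q [u [-> qJ uJ ur]]]; exists q, u; split => //; exact: le_trans ur rs. Qed.

End piece.

Section bounded.
Context {R : realType} {d : nat}.

Lemma vol_lty (A : set 'rV[R]_d) (b : 'I_d -> R) : measurable A ->
  (forall x i, A x -> `|x ord0 i| <= b i) -> (vol A < +oo)%E.
Proof.
move=> mA Ab.
pose B i : set (measurableTypeR R) := `[- b i, b i]%classic.
have mB i : measurable (B i) by exact: measurable_itv.
have AB : A `<=` [set x : 'rV[R]_d | forall i, B i (x ord0 i)].
  by move=> x Ax i; rewrite /B/= in_itv/= -ler_norml; exact: Ab.
apply: (@le_lt_trans _ _ (vol [set x : 'rV[R]_d | forall i, B i (x ord0 i)])).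
  by apply: le_measure; rewrite ?inE//; exact: measurable_box.
rewrite vol_box// (_ : (\prod_(i < d) _)%E =
    (\prod_(i < d) fine (lebesgue_measure (B i)))%:E) ?ltry//.
rewrite -prodEFin; apply: eq_bigr => i _; rewrite fineK//.
rewrite /B lebesgue_measure_itv/=; case: ifP => // _.
Qed.

Lemma measurable_enorm_le (r : R) : measurable [set x : 'rV[R]_d | enorm x <= r].
Proof.
have [r0|r0] := leP 0 r; last first.
  rewrite (_ : [set x | _] = set0) ?measurable0//.
  by apply/seteqP; split => // x /=; rewrite leNgt (lt_le_trans r0)// enorm_ge0.
rewrite (_ : [set x | _] = (fun x : 'rV[R]_d => dot x x) @^-1` `]-oo, r ^+ 2]%classic).
  apply: measurable_preimageT; last exact: measurable_itv.
  by apply: measurable_sum => i; apply: measurable_funM; exact: measurable_coord.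
by apply/seteqP; split => x /=; rewrite in_itv/= enorm_le.
Qed.

End bounded.

Section piece_scale.
Context {R : realType} {N d : nat} (p : 'I_N -> 'rV[R]_d).
Variables (I J : {set 'I_N}) (j0 : 'I_N).
Hypothesis j0J : j0 \in J.

(** Its row space is the direction space of the face spanned by the p i, i in J. *)
Let B : 'M[R]_(N, d) := \matrix_(i, c) if i \in J then (p i - p j0) ord0 c else 0.

Let row_B i : i \in J -> row i B = p i - p j0.
Proof. by move=> iJ; apply/rowP => c; rewrite !mxE iJ. Qed.

Let hull_sub q : hullI p J q -> (q - p j0 <= B)%MS.
Proof.
move=> /hullIP[l [_ lJ l1] ->]; rewrite -[p j0]scale1r -l1 scaler_suml -sumrB.
apply: summx_sub => i _; rewrite -scalerBr; have [iJ|iJ] := boolP (i \in J).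
  by rewrite scalemx_sub// -row_B// row_sub.
by rewrite lJ// scale0r sub0mx.
Qed.

Let face_orth u : face p I u = J -> forall i, dot (row i B) u = 0.
Proof.
move=> uJ i; have [iJ|iJ] := boolP (i \in J).
  by rewrite row_B// (piece_orthogonal (hullI_point iJ) uJ).
rewrite (_ : row i B = 0) ?dot0l//.
by apply/rowP => c; rewrite !mxE (negbTE iJ).
Qed.

Lemma piece_projection : exists P : 'M[R]_d, [/\ P *m P = P,
  forall q, hullI p J q -> (q - p j0) *m P = q - p j0 &
  forall u, face p I u = J -> u *m P = 0].
Proof.
have [P [PP PB P0]] := orthogonal_projection B.
by exists P; split => // [q /hull_sub/PB|u /face_orth/P0].
Qed.

(* y lies in the piece translated by p j0 iff its component along J does so in
   the face and its orthogonal component in the normal cone. *)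
Let slice (P : 'M[R]_d) (r : R) : set 'rV[R]_d := [set y |
  [/\ hullI p J (y *m P + p j0), face p I (y *m (1%:M - P)) = J &
      enorm (y *m (1%:M - P)) <= r]].

Let measurable_slice P r : measurable (slice P r).
Proof.
have mP := measurable_preimageT (measurable_row_affine P (p j0)) (measurable_hullI p J).
have mf : measurable [set y | face p I (y *m (1%:M - P)) = J].
  exact: measurable_mulmx (measurable_face p I J).
have me : measurable [set y : 'rV[R]_d | enorm (y *m (1%:M - P)) <= r].
  exact: (@measurable_mulmx _ _ (1%:M - P) _ (measurable_enorm_le r)).
have := measurableI _ _ mP (measurableI _ _ mf me).
congr measurable; apply/seteqP.
by split=> y /=; [case=> ? []|case].
Qed.

(** The projection recovers q - p j0 and u from x - p j0, so the existential quantifiers in [piece]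
    turn into explicit functions of x; measurability and scaling can be read off. *)
Let piece_slice P r : P *m P = P ->
  (forall q, hullI p J q -> (q - p j0) *m P = q - p j0) ->
  (forall u, face p I u = J -> u *m P = 0) ->
  piece p I J r = [set x | slice P r (x - p j0)].
Proof.
move=> PP Pq Pu; apply/seteqP; split => x /=.
  move=> [q [u [-> qJ uJ ur]]].
  have E1 : (q + u - p j0) *m P = q - p j0.
    by rewrite addrAC mulmxDl Pq// Pu// addr0.
  have E2 : (q + u - p j0) *m (1%:M - P) = u.
    by rewrite mulmxBr mulmx1 E1 (addrC q u) -(addrA u) addrK.
  by split; rewrite ?E1 ?E2 ?subrK.
move=> [qJ uJ ur]; exists ((x - p j0) *m P + p j0), ((x - p j0) *m (1%:M - P)).
split => //; rewrite mulmxBr mulmx1 addrAC.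
by rewrite (addrC (_ *m _)) !subrK.
Qed.

Lemma measurable_piece r : measurable (piece p I J r).
Proof.
have [P [PP Pq Pu]] := piece_projection.
rewrite (piece_slice r PP Pq Pu).
have := measurable_preimageT (measurable_row_affine 1%:M (- p j0)) (measurable_slice P r).
by congr measurable; apply/seteqP; split => x /=; rewrite mulmx1.
Qed.

Lemma vol_piece_lty r : (vol (piece p I J r) < +oo)%E.
Proof.
apply: (@vol_lty _ _ _ (fun c => \sum_i `|p i ord0 c| + r)); first exact: measurable_piece.
move=> x c [q [u [-> qJ _ ur]]]; rewrite mxE (le_trans (ler_normD _ _))// lerD//.
  exact: hullI_coord_le qJ.
exact: le_trans (coord_le_enorm u c) ur.
Qed.

(** P + r (1 - P) fixes the face component of a point and multiplies its normal component by r; as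
    [face] is invariant under positive scaling, the preimage of the slice of height r is the slice
    of height 1. *)
Lemma vol_piece : exists m, [/\ (m <= d)%N,
  m = d -> forall i, i \in J -> p i = p j0 &
  forall r, 0 <= r -> vol (piece p I J r) = ((r ^+ m)%:E * vol (piece p I J 1))%E].
Proof.
have [P [PP Pq Pu]] := piece_projection.
have [m [md mP0 mP1 scale]] := vol_idempotent_scale PP.
have vol_slice r : vol (piece p I J r) = vol (slice P r).
  rewrite (piece_slice r PP Pq Pu) -[RHS](vol_translation (- p j0))//.
have pos r : 0 < r -> vol (piece p I J r) = ((r ^+ m)%:E * vol (piece p I J 1))%E.
  move=> r0; rewrite !vol_slice (scale r)//; congr (_ * vol _)%E.
  have QP : (1%:M - P) *m P = 0 by rewrite mulmxBl mul1mx PP subrr.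
  have PQ : P *m (1%:M - P) = 0 by rewrite mulmxBr mulmx1 PP subrr.
  have QQ : (1%:M - P) *m (1%:M - P) = 1%:M - P by rewrite mulmxBr mulmx1 QP subr0.
  apply/seteqP; split => y; rewrite /slice/= -!mulmxA !mulmxDl -!scalemxAl.
    rewrite PP QP PQ QQ scaler0 addr0 add0r -!scalemxAr faceZ//.
    by rewrite enormZ ?(ltW r0)// -{2}[r]mulr1 ler_pM2l//.
  rewrite PP QP PQ QQ scaler0 addr0 add0r -!scalemxAr faceZ//.
  by rewrite enormZ ?(ltW r0)// -{2}[r]mulr1 ler_pM2l//.
exists m; split => //.
  move=> /mP0 P0 i iJ; apply/eqP; rewrite -subr_eq0 -(Pq _ (hullI_point iJ)).
  by rewrite P0 mulmx0.
move=> r; rewrite le_eqVlt => /orP[/eqP <-|]; last exact: pos.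
(* Height 0 is treated apart, as scaling needs r > 0. If m = 0, then P is the identity, the only
   possible normal is 0, and the pieces of heights 0 and 1 coincide. *)
have [m0|m0] := eqVneq m 0%N.
  rewrite m0 expr0 mul1e; congr (vol _); apply/seteqP; split; first exact: piece_le.
  move=> x [q [u [-> qJ uJ ur]]]; exists q, u; split => //.
  have := Pu _ uJ; rewrite (mP1 m0) mulmx1 => ->.
  by rewrite enormE dot0l sqrtr0.
rewrite expr0n (negbTE m0) mul0e; apply/eqP; rewrite eq_le measure_ge0 andbT.
have := vol_piece_lty 1; have := vol_piece_lty 0.
rewrite -!ge0_fin_numE ?measure_ge0// => /fineK v0 /fineK v1.
rewrite -v0 lee_fin leNgt; apply/negP; set a := fine _ => a0.
set b := fine _ in v1.
have b0 : 0 <= b by rewrite fine_ge0.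
have ab0 : 0 < a + b by rewrite ltr_wpDr.
(* If the piece of height 0 had volume a > 0, then with b the volume at height 1 and s = a / (a +
   b), monotonicity would give a <= s^m b <= s b < a. *)
have s0 : 0 < a / (a + b) by rewrite divr_gt0.
have : (vol (piece p I J 0) <= vol (piece p I J (a / (a + b))))%E.
  apply: le_measure; rewrite ?inE; [exact: measurable_piece..|].
  by apply: piece_le; exact: ltW.
rewrite (pos _ s0) -v1 -v0 -/a -EFinM lee_fin leNgt => /negP; apply.
have s1 : a / (a + b) <= 1 by rewrite ler_pdivrMr// mul1r lerDl.
apply: (@le_lt_trans _ _ (a / (a + b) * b)).
  rewrite ler_wpM2r// -[leRHS]expr1 ler_wiXn2l ?lt0n//; exact: ltW.
by rewrite mulrAC ltr_pdivrMr// ltr_pM2l// ltrDr.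
Qed.

End piece_scale.

Lemma measure_finType_bigcup dT (T : measurableType dT) (R : realType)
    (mu : {measure set T -> \bar R}) (I : finType) (F : I -> set T) :
  (forall i, measurable (F i)) -> trivIset setT F ->
  (mu (\bigcup_i F i) = \sum_(i : I) mu (F i))%E.
Proof.
move=> mF tF.
have -> : \bigcup_i F i = \bigcup_(i in [set` index_enum I]) F i.
  by apply/seteqP; split => x [i _ Fix]; exists i => //=; rewrite mem_index_enum.
rewrite measure_fin_bigcup//; last exact: sub_trivIset tF.
by rewrite -fsbig_seq ?index_enum_uniq.
Qed.

(** This is r^m - s^m <= m c r^(m-2), multiplied by r^2 to avoid negative exponents. In the
    induction, r^(m+1) - s^(m+1) = r (r^m - s^m) + s^m (r - s), and r (r - s) <= r^2 - s^2 <= c. *)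
Lemma expr_diff_le (R : realFieldType) (r s c : R) (m : nat) : 0 <= s -> s <= r ->
  r ^+ 2 - s ^+ 2 <= c -> r ^+ 2 * (r ^+ m - s ^+ m) <= m%:R * c * r ^+ m.
Proof.
move=> s0 sr rsc; have r0 : 0 <= r by exact: le_trans sr.
elim: m => [|m IH]; first by rewrite !expr0 subrr mulr0 !mul0r.
have -> : r ^+ 2 * (r ^+ m.+1 - s ^+ m.+1) =
    r * (r ^+ 2 * (r ^+ m - s ^+ m)) + s ^+ m * r * (r * (r - s)).
  rewrite !exprS; lra.
have -> : m.+1%:R * c * r ^+ m.+1 = r * (m%:R * c * r ^+ m) + r ^+ m * r * c.
  rewrite -natr1 !exprS; lra.
apply: lerD; first by rewrite ler_wpM2l.
have rs0 : 0 <= r * (r - s) by rewrite mulr_ge0// subr_ge0.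
have rsc' : r * (r - s) <= c.
  apply: le_trans rsc; have : 0 <= s * (r - s) by rewrite mulr_ge0// subr_ge0.
  by rewrite !expr2; lra.
apply: ler_pM => //; first by rewrite mulr_ge0// exprn_ge0.
rewrite ler_wpM2r// lerXn2r// nnegrE//.
Qed.

Section balls.
Context {R : realType} {d : nat}.

Lemma measurable_cball (x : 'rV[R]_d) r : measurable (cball x r).
Proof.
have := measurable_preimageT (measurable_row_affine 1%:M (- x)) (measurable_enorm_le r).
by congr measurable; apply/seteqP; split => y /=; rewrite mulmx1.
Qed.

Lemma vol_cball_lty (x : 'rV[R]_d) r : (vol (cball x r) < +oo)%E.
Proof.
apply: (@vol_lty _ _ _ (fun c => r + `|x ord0 c|)); first exact: measurable_cball.
move=> y c yr; rewrite -[y](subrK x) mxE (le_trans (ler_normD _ _))// lerD//.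
exact: le_trans (coord_le_enorm _ _) yr.
Qed.

(** Solving Steiner's formula for the intrinsic volumes divides by [kappa]. The unit ball contains a
    cube of side 1 / (d + 1). *)
Lemma kappa_gt0 : 0 < kappa R d.
Proof.
pose a : R := d.+1%:R^-1.
have a0 : 0 < a by rewrite invr_gt0.
pose B (i : 'I_d) : set (measurableTypeR R) := `[0, a]%classic.
have mB i : measurable (B i) by exact: measurable_itv.
have Bball : [set x : 'rV[R]_d | forall i, B i (x ord0 i)] `<=` cball 0 1.
  move=> x xB; rewrite /cball/= subr0 enorm_le// expr1n.
  apply: (@le_trans _ _ (\sum_(i < d) a)).
    apply: ler_sum => i _; have := xB i; rewrite /B/= in_itv/= => /andP[x0 xa].
    have a1 : a <= 1 by rewrite invf_le1// ler1n.
    by rewrite -[a]mulr1 ler_pM// (le_trans xa).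
  rewrite sumr_const card_ord -mulr_natl /a ler_pdivrMr// mul1r ler_nat.
  exact: leqnSn.
have : (vol [set x : 'rV[R]_d | forall i, B i (x ord0 i)] <= vol (@cball R d 0 1))%E.
  by apply: le_measure; rewrite ?inE//; [exact: measurable_box|exact: measurable_cball].
rewrite vol_box// (eq_bigr (fun=> a%:E)) => [|i _]; last first.
  by rewrite /B lebesgue_measure_itv/= lte_fin a0 oppr0 adde0.
rewrite prodEFin /kappa => h; rewrite -lte_fin fineK ?ge0_fin_numE ?measure_ge0 ?vol_cball_lty//.
by apply: lt_le_trans h; rewrite lte_fin prodr_gt0.
Qed.

End balls.

(** * Parallel bodies compared with unions of balls *)

Section parallel_body.
Context {R : realType} {N d : nat} (p : 'I_N -> 'rV[R]_d) (I : {set 'I_N}).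
Hypothesis I0 : I != finset.set0.

Local Notation parallel r := (minkowski_sum (hullI p I) (cball 0 r)).

Let face_sub u : {subset face p I u <= I}.
Proof. by move=> j /faceP[]. Qed.

(** If q1 + u1 = q2 + u2, then |q2 - q1|^2 is the product of q2 - q1 with u1 - u2, which is at most
    0 because u1 and u2 are outer normals at q1 and q2. So x determines q and u, and u determines
    J. *)
Lemma trivIset_piece r : trivIset setT (fun J => piece p I J r).
Proof.
apply/trivIsetP => /= J1 J2 _ _; apply: contraNeq => /set0P[x].
move=> [[q1 [u1 [x1 q1J uJ1 _]]] [q2 [u2 [x2 q2J uJ2 _]]]].
suff q12 : q1 = q2.
  by rewrite -uJ1 -uJ2; apply/eqP; congr face; apply: (addrI q1); rewrite -x1 x2 q12.
have le (J J' : {set 'I_N}) q q' u : hullI p J q -> hullI p J' q' -> face p I u = J ->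
    {subset J' <= I} -> dot (q' - q) u <= 0.
  move=> qJ q'J' uJ J'I; have [j jJ] := hullI_neq0 qJ.
  rewrite -(subrK (p j) q') -addrA -(opprB q) dotBl (piece_orthogonal qJ uJ jJ) subr0.
  rewrite dotBl subr_le0 (dot_hullI_le q'J')// => i /J'I iI.
  by move: jJ; rewrite -uJ => /faceP[_]; exact.
have J1I : {subset J1 <= I} by rewrite -uJ1; exact: face_sub.
have J2I : {subset J2 <= I} by rewrite -uJ2; exact: face_sub.
have h1 := le _ _ _ _ _ q1J q2J uJ1 J2I.
have h2 := le _ _ _ _ _ q2J q1J uJ2 J1I.
have u12 : q2 - q1 = u1 - u2.
  by apply/eqP; rewrite subr_eq addrAC eq_sym subr_eq addrC -x1 x2.
have : dot (q2 - q1) (q2 - q1) <= 0.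
  rewrite {2}u12 dotBr; move: h2; rewrite -(opprB q2) dotNl; lra.
move=> h; apply/esym/eqP; rewrite -subr_eq0; apply/eqP/dot_eq0/eqP.
by rewrite eq_le h dot_ge0.
Qed.

Lemma parallel_pieces r : parallel r = \bigcup_J piece p I J r.
Proof.
apply/seteqP; split => x; last first.
  move=> [J _ [q [u [-> qJ uJ ur]]]]; exists q, u; split => //.
    by apply: hullI_sub qJ; rewrite -uJ; exact: face_sub.
  by rewrite /cball/= subr0.
move=> [y [b [yI]]]; rewrite /cball/= subr0 => br ->.
have [q qI qmin] := nearest_point p (y + b) I0.
exists (face p I (y + b - q)) => //; exists q, (y + b - q); split => //.
- by rewrite [RHS]addrC subrK.
(* The products of p j - q with the normal are at most 0 and their weighted sum is 0, so every index
   of nonzero weight attains the maximum; thus q lies in the hull of the face. *)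
- move: (qI) => /hullIP[l [l0 lI l1] qE]; apply/hullIP; exists l => //; split => // i.
  apply: contraNeq => li; apply/faceP.
  have iI : i \in I by apply: contraNT li => /lI/eqP.
  split => // k kI.
  suff -> : dot (p i) (y + b - q) = dot q (y + b - q).
    by rewrite -subr_le0 -dotBl qmin.
  have : \sum_j l j * dot (p j - q) (y + b - q) = 0.
    under eq_bigr do rewrite -dotZl.
    rewrite -dot_suml; under eq_bigr do rewrite scalerBr.
    by rewrite sumrB -qE -scaler_suml l1 scale1r subrr dot0l.
  move=> /eqP; rewrite -oppr_eq0 -sumrN psumr_eq0 => [/allP/(_ i)|j _].
    rewrite mem_index_enum oppr_eq0 mulf_eq0 (negbTE li)/= dotBl subr_eq0.
    by move=> /(_ isT)/eqP.
  rewrite oppr_ge0; have [jI|/lI ->] := boolP (j \in I); last by rewrite mul0r.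
  by rewrite mulr_ge0_le0// qmin.
have r0 : 0 <= r by rewrite (le_trans _ br)// enorm_ge0.
rewrite enorm_le//; move: br; rewrite enorm_le//; apply: le_trans.
(* With v = y + b - q and w = y - q one has b = v - w and dot w v <= 0, hence |v| <= |b| <= r. *)
have : dot (y - q) (y + b - q) <= 0.
  by rewrite dotBl subr_le0 (dot_hullI_le yI)// => i iI; rewrite -subr_le0 -dotBl qmin.
have : dot b b = dot (y + b - q - (y - q)) (y + b - q - (y - q)).
  by rewrite opprB addrA subrK addrAC subrr add0r.
set v := y + b - q; set w := y - q => -> wv.
clearbody v w.
by have := dot_ge0 w; rewrite dotBl !dotBr (dotC v w); lra.
Qed.

(** The square of a bound for the diameter of the hull, obtained coordinate by coordinate. *)
Let D2 : R := \sum_(c < d) (2 * \sum_i `|p i ord0 c|) ^+ 2.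

Let dist_le q q' : hullI p I q -> hullI p I q' -> dot (q - q') (q - q') <= D2.
Proof.
move=> qI q'I; apply: ler_sum => c _; rewrite -expr2 -real_normK ?num_real//.
rewrite lerXn2r// ?nnegrE//; first by rewrite mulr_ge0// sumr_ge0.
rewrite !mxE (le_trans (ler_normB _ _))// mulr2n mulrDl mul1r.
by rewrite lerD//; [exact: hullI_coord_le qI|exact: hullI_coord_le q'I].
Qed.

Local Notation balls r := (\bigcup_(i in [set` I]) cball (p i) r).

Let balls_parallel r : balls r `<=` parallel r.
Proof.
move=> x [i iI xi]; exists (p i), (x - p i); split => //.
- exact: hullI_point.
- by rewrite /cball/= subr0.
- by rewrite [RHS]addrC subrK.
Qed.

(** For j in J the vector q - p j is orthogonal to u and has squared length at most [D2], so
    Pythagoras applies. *)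
Let piece_balls J r s : 0 <= s -> 0 <= r -> s ^+ 2 + D2 <= r ^+ 2 ->
  piece p I J s `<=` balls r.
Proof.
move=> s0 r0 sDr x [q [u [-> qJ uJ us]]]; have [j jJ] := hullI_neq0 qJ.
have JI : {subset J <= I} by rewrite -uJ; exact: face_sub.
exists j; first exact: JI.
have : dot (q - p j) (q - p j) <= D2.
  by apply: dist_le; [exact: hullI_sub qJ|apply: hullI_point; exact: JI].
have := piece_orthogonal qJ uJ jJ.
rewrite /cball/= addrAC enorm_le//; set a := q - p j; clearbody a => au aD.
rewrite dotDl !dotDr (dotC u a) au addr0 add0r (le_trans _ sDr)// addrC lerD//.
by rewrite -enorm_le.
Qed.

Let piece_balls_vertex (J : {set 'I_N}) j (r : R) : j \in J -> (forall i, i \in J -> p i = p j) ->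
  piece p I J r `<=` balls r.
Proof.
move=> jJ pJ x [q [u [-> /hullIP[l [l0 lJ l1] qE] uJ us]]].
exists j; first by apply: (@face_sub u); rewrite uJ.
suff -> : q = p j by rewrite /cball/= addrAC subrr add0r.
rewrite qE -[RHS]scale1r -l1 scaler_suml; apply: eq_bigr => i _.
by have [/pJ ->//|/lJ ->] := boolP (i \in J); rewrite !scale0r.
Qed.

Let mpiece J r : measurable (piece p I J r).
Proof.
have [->|[j jJ]] := set_0Vmem J; last exact: measurable_piece jJ r.
rewrite (_ : piece _ _ _ _ = set0) ?measurable0//.
by apply/seteqP; split => // x [q [u [_ /hullI_neq0[i]]]]; rewrite inE.
Qed.

Let vol_pieces : exists (m : {set 'I_N} -> nat) (v : {set 'I_N} -> R),
  [/\ forall J, (m J <= d)%N, forall J, 0 <= v J,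
   forall J r, 0 <= r -> vol (piece p I J r) = (r ^+ m J * v J)%:E &
   forall J r, m J = d -> piece p I J r `<=` balls r].
Proof.
have h J : exists mv : nat * R, [/\ (mv.1 <= d)%N, 0 <= mv.2,
    forall r, 0 <= r -> vol (piece p I J r) = (r ^+ mv.1 * mv.2)%:E &
    forall r, mv.1 = d -> piece p I J r `<=` balls r].
  have [->|[j jJ]] := set_0Vmem J.
    have e0 r : piece p I finset.set0 r = set0.
      by apply/seteqP; split => // x [q [u [_ /hullI_neq0[i]]]]; rewrite inE.
    (* For empty J every piece is empty; exponent 0 and coefficient 0 serve. *)
    exists (0%N, 0); split => //= r; last by move=> _; rewrite e0; exact: sub0set.
    by move=> _; rewrite e0 measure0 mulr0.
  have [m [md mdJ volE]] := vol_piece p I jJ.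
  have fin1 : vol (piece p I J 1) = (fine (vol (piece p I J 1)))%:E.
    by rewrite fineK// ge0_fin_numE ?measure_ge0//; exact: vol_piece_lty jJ 1.
  exists (m, fine (vol (piece p I J 1))); split => //=.
  - by rewrite fine_ge0// measure_ge0.
  - by move=> r r0; rewrite volE// fin1.
  - by move=> r /mdJ pJ; exact: piece_balls_vertex jJ pJ.
have [f fE] := choice h.
exists (fst \o f), (snd \o f).
by split=> [J|J|J|J]; have [] := fE J.
Qed.

(** Grouping the volumes r^(m J) v_J by their exponent gives the coefficients c. The same polynomial
    is the exact volume of the parallel body and approximates that of the balls, which is squeezed
    between shortened pieces and the parallel body. *)
Lemma steiner_balls : exists c : nat -> R,
  (forall r, 0 <= r -> vol (parallel r) = (\sum_(k < d.+1) c k * r ^+ k)%:E) /\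
  exists C r0 : R, forall r, r0 <= r ->
    `|fine (vol (balls r)) - \sum_(k < d.+1) c k * r ^+ k| <= C * (r ^+ d.-1 / r ^+ 2).
Proof.
have [m [v [md v0 volE vert]]] := vol_pieces.
pose c k := \sum_(J | m J == k) v J.
have cE r : \sum_(k < d.+1) c k * r ^+ k = \sum_J r ^+ m J * v J.
  rewrite (partition_big (fun J => inord (m J) : 'I_d.+1) xpredT)//=.
  apply: eq_bigr => k _; rewrite /c mulr_suml.
  apply: eq_big => [J|J /eqP ->]; last by rewrite mulrC.
  apply/eqP/eqP => [mJ|<-]; last by rewrite inordK// ltnS.
  by apply: val_inj; rewrite /= inordK ?mJ// ltn_ord.
have volP r : 0 <= r -> vol (parallel r) = (\sum_(k < d.+1) c k * r ^+ k)%:E.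
  move=> r0; rewrite cE parallel_pieces measure_finType_bigcup//; last exact: trivIset_piece.
  by rewrite -sumEFin; apply: eq_bigr => J _; exact: volE.
exists c; split => //.
(* The threshold 1 + D2 ensures both r >= 1 and r^2 >= D2, so that the square root s below makes
   sense. *)
exists (\sum_J (m J)%:R * D2 * v J), (1 + D2) => r rD.
have D20 : 0 <= D2 by apply: sumr_ge0 => i _; rewrite sqr_ge0.
have r1 : 1 <= r by apply: le_trans rD; rewrite lerDl.
have r0 : 0 < r by exact: lt_le_trans r1.
have rD2 : 0 <= r ^+ 2 - D2.
  rewrite subr_ge0 (@le_trans _ _ r)//; first by apply: le_trans rD; rewrite lerDr.
  by rewrite expr2 ler_peMl// ltW.
pose s := Num.sqrt (r ^+ 2 - D2).
have s0 : 0 <= s by exact: sqrtr_ge0.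
have s2 : s ^+ 2 = r ^+ 2 - D2 by rewrite sqr_sqrtr.
have sr : s <= r.
  by rewrite -(@ler_pXn2r _ 2%N)// ?nnegrE ?s2 ?gerBl// ltW.
have mballs : measurable (balls r).
  apply: fin_bigcup_measurable => [|i _]; first exact: finite_finset.
  exact: measurable_cball.
have le_up : (vol (balls r) <= vol (parallel r))%E.
  apply: le_measure; rewrite ?inE//.
  by rewrite parallel_pieces; apply: fin_bigcup_measurable.
(* The balls contain the part of height [t J] of the piece J. *)
pose t J := if m J == d then r else s.
have t0 J : 0 <= t J by rewrite /t; case: ifP => // _; exact: ltW.
have tr J : t J <= r by rewrite /t; case: ifP.
have le_dn : ((\sum_J t J ^+ m J * v J)%:E <= vol (balls r))%E.
  rewrite -sumEFin (eq_bigr (fun J => vol (piece p I J (t J)))); last first.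
    by move=> J _; exact/esym/volE.
  rewrite -measure_finType_bigcup//.
    apply: le_measure; rewrite ?inE//; first exact: fin_bigcup_measurable.
    move=> x [J _]; rewrite /t; case: eqP => [mJ|_]; first exact: (vert J r mJ).
    by apply: piece_balls => //; [exact: ltW|rewrite s2 subrK].
  apply/trivIsetP => J1 J2 _ _ J12.
  have /trivIsetP/(_ J1 J2 Logic.I Logic.I J12) := @trivIset_piece r.
  by apply: subsetI_eq0; exact: piece_le.
have fin : vol (balls r) = (fine (vol (balls r)))%:E.
  rewrite fineK// ge0_fin_numE ?measure_ge0// (le_lt_trans le_up)// volP ?ltry//.
  exact: ltW.
rewrite distrC ger0_norm; last first.
  by rewrite subr_ge0 -lee_fin -fin -volP// ltW.
rewrite cE; apply: (@le_trans _ _ (\sum_J (r ^+ m J * v J - t J ^+ m J * v J))).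
  by rewrite sumrB lerD2l lerN2 -lee_fin -fin.
rewrite mulr_suml; apply: ler_sum => J _; rewrite -mulrBl.
rewrite -mulrA [v J * _]mulrC mulrA ler_wpM2r//.
have [mJ|mJ] := eqVneq (m J) d.
  by rewrite /t mJ eqxx subrr !mulr_ge0// ?invr_ge0 exprn_ge0 ?ltW.
rewrite /t (negbTE mJ) mulrA ler_pdivlMr ?exprn_gt0// mulrC.
apply: (@le_trans _ _ ((m J)%:R * D2 * r ^+ m J)).
  by apply: expr_diff_le => //; rewrite s2 opprB addrC subrK.
rewrite ler_wpM2l ?mulr_ge0// ler_weXn2l//.
(* Here m J <= d and m J differs from d, whence m J <= d - 1. *)
by move: (md J) mJ; rewrite leq_eqVlt => /orP[->//|]; case: d.
Qed.

End parallel_body.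

(** * Boolean combinations of balls *)

Section boolean_combinations.
Context {N : nat}.
Implicit Types (f g : freeBA N) (I J L T : {set 'I_N}).

Lemma CN_setU f g : CN f -> CN g -> CN (f `|` g).
Proof. by move=> [s _ <-] [t _ <-]; exists (CCup s t). Qed.

Lemma CN_setD f g : CN f -> CN g -> CN (f `\` g).
Proof. by move=> [s _ <-] [t _ <-]; exists (CDiff s t). Qed.

(** The atom [finset.set0] is the meet of the complements of all generators, out of reach without
    complementation. Its absence makes flowers bounded and leaves only nonempty atoms to expand. *)
Lemma CN_not0 f : CN f -> ~ f finset.set0.
Proof.
move=> [t _ <-]; elim: t => [i|s IHs t IHt|s IHs t IHt|s IHs t IHt] /=.
- by rewrite /gen/= inE.
- by case.
- by case.
- by case.
Qed.

Lemma csubst_CN f (U : Type) (A : 'I_N -> set U) (x : U) : CN f ->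
  csubst f A x <-> f [set i | `[< A i x >]]%SET.
Proof. by move=> [t _ <-]; rewrite csubstE; exact: ceval_gen. Qed.

Lemma ugenP I J : ugen I J <-> exists2 i, i \in I & i \in J.
Proof. by split=> -[i iI iJ]; exists i. Qed.

Hypothesis N0 : (0 < N)%N.

Lemma CN_set0 : CN (set0 : freeBA N).
Proof.
exists (CDiff (CVar (Ordinal N0)) (CVar (Ordinal N0))) => //=.
by rewrite setDv.
Qed.

Lemma CN_ugen I : CN (ugen I).
Proof.
rewrite /ugen (_ : [set` I] = [set i | (i \in index_enum 'I_N) && (i \in I)]).
  rewrite bigcup_seq_cond; apply: big_ind => [|f g|i _]; [exact: CN_set0|exact: CN_setU|].
  by exists (CVar i).
by apply/seteqP; split => i /=; rewrite mem_index_enum.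
Qed.

Section span.
Variable R : realType.

(** The existence of the coefficients: one integer vector m must serve all valuations. The property
    passes to disjoint unions and to differences of nested elements, which suffices to reach every
    atom. *)
Definition ugen_span f : Prop := CN f /\ exists m : {ffun {set 'I_N} -> int},
  forall mu : freeBA N -> R, additive_on_CN mu ->
    mu f = \sum_(I : {set 'I_N} | I != finset.set0) (m I)%:~R * mu (ugen I).

Lemma ugen_span_set0 : ugen_span set0.
Proof.
split; first exact: CN_set0.
exists [ffun=> 0] => mu muD; rewrite big1 => [|I _]; last by rewrite ffunE mul0r.
by have := muD _ _ CN_set0 CN_set0 (set0I _); rewrite setU0; lra.
Qed.

Lemma ugen_span_setU f g : ugen_span f -> ugen_span g -> f `&` g = set0 ->
  ugen_span (f `|` g).
Proof.
move=> [Cf [mf mfE]] [Cg [mg mgE]] fg; split; first exact: CN_setU.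
exists [ffun I => mf I + mg I] => mu muD; rewrite muD// mfE// mgE// -big_split/=.
by apply: eq_bigr => I _; rewrite ffunE intrD mulrDl.
Qed.

Lemma ugen_span_setD f g : ugen_span f -> ugen_span g -> f `<=` g ->
  ugen_span (g `\` f).
Proof.
move=> [Cf [mf mfE]] [Cg [mg mgE]] fg; have CD := CN_setD Cg Cf; split => //.
exists [ffun I => mg I - mf I] => mu muD.
have : mu g = mu (g `\` f) + mu f.
  by rewrite -muD// ?setDUK// ?[_ `|` f]setUC ?setDUK// setIC setDIK.
rewrite mfE// mgE// => /esym/(canRL (addrK _)) ->; rewrite -sumrB.
by apply: eq_bigr => I _; rewrite ffunE intrB mulrBl.
Qed.

Lemma ugen_span_ugen I : ugen_span (ugen I).
Proof.
have [->|I0] := eqVneq I finset.set0.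
  rewrite (_ : ugen _ = set0); first exact: ugen_span_set0.
  by apply/seteqP; split => // J /ugenP[i]; rewrite inE.
split; first exact: CN_ugen.
exists [ffun J => (J == I)%:R] => mu muD; rewrite (bigD1 I)//= ffunE eqxx mul1r.
by rewrite big1 ?addr0// => J /andP[_ /negbTE JI]; rewrite ffunE JI mul0r.
Qed.

(** A set of atoms is a disjoint union of singletons, added one at a time and skipping
    repetitions. *)
Lemma ugen_span_atoms (P : pred {set 'I_N}) :
  (forall L, P L -> ugen_span [set L]) -> ugen_span [set L | P L].
Proof.
move=> Pspan; have key (s : seq {set 'I_N}) : ugen_span [set L | (L \in s) && P L].
  elim: s => [|L s IH].
    rewrite (_ : [set L | _] = set0); first exact: ugen_span_set0.
    by apply/seteqP; split.
  have [PL|PL] := boolP (P L); last first.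
    rewrite (_ : [set K | _] = [set K | (K \in s) && P K])//.
    apply/seteqP; split => K /=; rewrite inE.
      by case/andP => /orP[/eqP -> PL'|-> ->//]; rewrite PL' in PL.
    by case/andP => -> ->; rewrite orbT.
  have [Ls|Ls] := boolP (L \in s).
    rewrite (_ : [set K | _] = [set K | (K \in s) && P K])//.
    apply/seteqP; split => K /=; rewrite inE.
      by case/andP => /orP[/eqP -> ->|-> ->//]; rewrite Ls.
    by case/andP => -> ->; rewrite orbT.
  rewrite (_ : [set K | _] = [set L] `|` [set K | (K \in s) && P K]).
    apply: ugen_span_setU => //; first exact: Pspan.
    by apply/seteqP; split => // K [/= ->]; rewrite (negbTE Ls).
  apply/seteqP; split => K /=; rewrite inE.
    by case/andP => /orP[/eqP ->|-> ->]; [left|right].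
  by case=> [->|/andP[-> ->]]; rewrite ?eqxx ?PL ?orbT.
have := key (index_enum {set 'I_N}); congr ugen_span.
by apply/seteqP; split => L /=; rewrite mem_index_enum.
Qed.

(* Moebius inversion: the nonempty subsets of T are the atoms of ugen setT that
   lie outside ugen (~: T). *)
Lemma ugen_span_atom T : T != finset.set0 -> ugen_span [set T].
Proof.
have [k] := ubnP #|T|; elim: k T => // k IH T cT T0.
have : ugen_span [set L : {set 'I_N} | (L \proper T) && (L != finset.set0)].
  apply: ugen_span_atoms => L /andP[LT L0]; apply: IH => //.
  by rewrite -ltnS (leq_trans _ cT)// ltnS proper_card.
have : ugen_span (ugen [set: 'I_N]%SET `\` ugen (~: T)%SET).
  apply: ugen_span_setD; [exact: ugen_span_ugen..|].
  by move=> L /ugenP[i _ iL]; apply/ugenP; exists i.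
have UE (L : {set 'I_N}) : (ugen [set: 'I_N]%SET `\` ugen (~: T)%SET) L <-> L \subset T /\ L != finset.set0.
  split=> [[/ugenP[i _ iL] LT]|[/fintype.subsetP LT /set0Pn[i iL]]].
    split; last by apply/set0Pn; exists i.
    apply/fintype.subsetP => j jL; apply/negPn/negP => jT; apply: LT.
    by apply/ugenP; exists j => //; rewrite inE.
  split; first by apply/ugenP; exists i.
  by move=> /ugenP[j]; rewrite inE => /negP jT /LT.
move=> sU sP; have := ugen_span_setD sP sU; rewrite (_ : _ `\` [set L | _] = [set T]).
  by apply=> L /= /andP[LT L0]; apply/UE; rewrite proper_sub.
apply/seteqP; split => L /=.
  move=> [/UE[LT L0]]; rewrite L0 andbT finset.properEneq LT andbT => /negP.
  by rewrite negbK => /eqP.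
move=> ->; split; first by apply/UE.
by rewrite fintype.properxx.
Qed.

(** Once an expansion exists, [xget] returns one. It exists because f is the union of its atoms, all
    nonempty. *)
Lemma mcoefP f : CN f -> forall mu : freeBA N -> R, additive_on_CN mu ->
  mu f = \sum_(I : {set 'I_N} | I != finset.set0) (mcoef R f I)%:~R * mu (ugen I).
Proof.
move=> Cf; rewrite /mcoef.
suff [_ [m mE]] : ugen_span f.
  exact: (@xgetPex {ffun {set 'I_N} -> int} 0 [set m | forall mu : freeBA N -> R,
    additive_on_CN mu -> mu f = \sum_(I : {set 'I_N} | I != finset.set0)
      (m I)%:~R * mu (ugen I)] (ex_intro _ m mE)).
have -> : f = [set L | `[< f L >]] by apply/seteqP; split => L /= /asboolP.
apply: ugen_span_atoms => L /asboolP fL; apply: ugen_span_atom.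
by apply/eqP => L0; apply: (CN_not0 Cf); rewrite -L0.
Qed.

End span.
End boolean_combinations.

(** * The volume of a flower as a valuation *)

Section flower.
Context {R : realType} {N d : nat} (p : 'I_N -> 'rV[R]_d) (r : R).

Local Notation flower f := (csubst f (fun i => cball (p i) r)).

Lemma measurable_flower f : CN f -> measurable (flower f).
Proof.
move=> [t _ <-]; rewrite csubstE; elim: t => [i|s IHs t IHt|s IHs t IHt|s IHs t IHt] /=.
- exact: measurable_cball.
- exact: measurableU.
- exact: measurableI.
- exact: measurableD.
Qed.

Lemma vol_flower_lty f : CN f -> (vol (flower f) < +oo)%E.
Proof.
move=> Cf; apply: (@vol_lty _ _ _ (fun c => \sum_i (`|r| + `|p i ord0 c|))).
  exact: measurable_flower.
move=> x c /(csubst_CN _ _ Cf) fx.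
(* A point outside all the balls would realize the empty atom, which no element of [CN] contains. *)
have [i xi] : exists i, cball (p i) r x.
  apply: contrapT => nx; apply: (CN_not0 Cf); move: fx; congr f.
  apply/setP => i; rewrite !inE; apply/asboolP => xi.
  by apply: nx; exists i.
rewrite (bigD1 i)//= -[leLHS]addr0 lerD//; last first.
  by apply: sumr_ge0 => j _; rewrite addr_ge0.
rewrite -[x](subrK (p i)) mxE (le_trans (ler_normD _ _))// lerD//.
exact: le_trans (coord_le_enorm _ _) (le_trans xi (ler_norm _)).
Qed.

Lemma flower_vol_additive : additive_on_CN (fun f => flower_vol f p r).
Proof.
move=> f g Cf Cg fg; rewrite /flower_vol.
have fin h : CN h -> vol (flower h) \is a fin_num.
  by move=> Ch; rewrite ge0_fin_numE ?measure_ge0// vol_flower_lty.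
rewrite -fineD ?fin// -measureU; [|exact: measurable_flower..|].
  congr (fine (vol _)); apply/seteqP; split => x.
    by move=> /(csubst_CN _ _ (CN_setU Cf Cg))[]; [left|right]; apply/csubst_CN.
  by move=> xfg; apply/(csubst_CN _ _ (CN_setU Cf Cg));
    case: xfg => /csubst_CN h; [left|right]; exact: h.
apply/seteqP; split => // x [/(csubst_CN _ _ Cf) fx /(csubst_CN _ _ Cg) gx].
have : (f `&` g) [set i | `[< cball (p i) r x >]]%SET by [].
by rewrite fg.
Qed.

Lemma flower_ugen (N0 : (0 < N)%N) I : flower (ugen I) = \bigcup_(i in [set` I]) cball (p i) r.
Proof.
apply/seteqP; split => x.
  move=> /(csubst_CN _ _ (CN_ugen N0 I))/ugenP[i iI]; rewrite inE => /asboolP xi.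
  by exists i.
move=> [i iI xi]; apply/(csubst_CN _ _ (CN_ugen N0 I))/ugenP; exists i => //.
by rewrite inE; apply/asboolP.
Qed.

End flower.

(** * Asymptotics *)

Section asymptotics.
Context {R : realType} {d : nat}.

(* r^(d-3) for d >= 1 and r > 0, without negative exponents. *)
Local Notation err r := (r ^+ d.-1 / r ^+ 2).

(** The estimate with error O(r^(d-3)) and explicit constants, easy to chain and to sum;
    [close_bigO] turns it into Landau notation. *)
Definition close_at_infinity (F G : R -> R) : Prop :=
  exists C r0 : R, forall r, r0 <= r -> `|F r - G r| <= C * err r.

Lemma close_trans F G H : close_at_infinity F G -> close_at_infinity G H ->
  close_at_infinity F H.
Proof.
move=> [C [r0 FG]] [C' [r0' GH]]; exists (C + C'), (Num.max r0 r0') => r.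
rewrite ge_max => /andP[rr0 rr0']; rewrite mulrDl.
by rewrite (le_trans (ler_distD (G r) _ _))// lerD// ?FG ?GH.
Qed.

Lemma close_sum (I : Type) (s : seq I) (P : pred I) (F G : I -> R -> R) (a : I -> R) :
  (forall i, P i -> close_at_infinity (F i) (G i)) ->
  close_at_infinity (fun r => \sum_(i <- s | P i) a i * F i r)
                    (fun r => \sum_(i <- s | P i) a i * G i r).
Proof.
move=> FG; elim: s => [|i s [C [r0 IH]]].
  by exists 0, 0 => r _; rewrite !big_nil subrr normr0 mul0r.
have [Pi|Pi] := boolP (P i); last first.
  by exists C, r0 => r /IH; rewrite !big_cons (negbTE Pi).
have [C' [r0' FGi]] := FG i Pi.
exists (`|a i| * C' + C), (Num.max r0' r0) => r.
rewrite ge_max => /andP[rr0' rr0]; rewrite !big_cons Pi.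
rewrite opprD addrACA (le_trans (ler_normD _ _))// mulrDl lerD//; last exact: IH.
by rewrite -mulrBr normrM -mulrA ler_wpM2l// FGi.
Qed.

(** The condition on a dropped exponent is e k <= d - 3, written additively so that it fails for d <
    3, where truncated subtraction would mislead. *)
Lemma close_truncate n (b : nat -> R) (e : nat -> nat) (P : pred nat) :
  (forall k, (k < n)%N -> ~~ P k -> (e k + 2 <= d.-1)%N) ->
  close_at_infinity (fun r => \sum_(k < n) b k * r ^+ e k)
                    (fun r => \sum_(k < n | P k) b k * r ^+ e k).
Proof.
move=> eP; exists (\sum_(k < n) `|b k|), 1 => r r1.
have r0 : 0 < r by exact: lt_le_trans r1.
rewrite (bigID (fun k : 'I_n => P k))/= addrAC subrr add0r.
rewrite (le_trans (ler_norm_sum _ _ _))// mulr_suml.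
rewrite [X in _ <= X](bigID (fun k : 'I_n => P k))/= -[leLHS]add0r lerD//.
  by apply: sumr_ge0 => k _; rewrite mulr_ge0// divr_ge0// exprn_ge0// ltW.
apply: ler_sum => k Pk; rewrite normrM ler_wpM2l// ger0_norm ?exprn_ge0 ?(ltW r0)//.
by rewrite ler_pdivlMr ?exprn_gt0// -exprD ler_weXn2l// eP.
Qed.

Lemma close_bigO (F G : R -> R) : (0 < d)%N -> close_at_infinity F G ->
  (F : R -> R^o) = G +O_ near_pinfty (fun r => r ^ (d%:Z - 3) : R^o).
Proof.
move=> d0 [C [r0 FG]]; apply/eqaddOP/bigO_exP; exists (`|C| + 1).
  by rewrite ltr_wpDl.
exists (Num.max 1 r0); split; first by rewrite num_real.
move=> r; rewrite gt_max => /andP[r1 rr0].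
have r_gt0 : 0 < r by exact: lt_trans r1.
have -> : r ^ (d%:Z - 3) = err r.
  have -> : d%:Z - 3 = d.-1%:Z - 2%:Z by rewrite -{1}(prednK d0) -addn1 PoszD -addrA.
  by rewrite expfzDr ?gt_eqF// -exprnP -exprnN.
apply: (le_trans (FG r (ltW rr0))).
have err0 : 0 <= err r by rewrite divr_ge0// exprn_ge0// ltW.
rewrite [X in _ <= _ * X]ger0_norm// ler_wpM2r//.
by rewrite (le_trans (ler_norm C))// lerDl.
Qed.

End asymptotics.

(** * Steiner's formula and the expansion at infinity *)

Section steiner_coefficients.
Context {R : realType} {N d : nat} (p : 'I_N -> 'rV[R]_d) (I : {set 'I_N}).
Hypothesis I0 : I != finset.set0.

Local Notation parallel r := (minkowski_sum (hullI p I) (cball 0 r)).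

(** The coefficients of [steiner_balls], divided by the binomials and extended by 0 above d, satisfy
    the defining property, so the value chosen by [xget] satisfies it too. *)
Lemma quermass_steiner r : 0 <= r -> vol (parallel r) =
  (\sum_(k < d.+1) 'C(d, k)%:R * quermass (hullI p I) k * r ^+ k)%:E.
Proof.
have [c [cE _]] := steiner_balls p I0; rewrite /quermass; set P := [set W | _].
have [_] : P (xget (fun=> 0) P); last exact.
apply: xgetPex; exists (fun k => if (k <= d)%N then c k / 'C(d, k)%:R else 0).
split => [k dk|s s0]; first by rewrite (leqNgt k) dk.
rewrite cE//; congr EFin; apply: eq_bigr => k _.
by rewrite -ltnS ltn_ord mulrCA mulfV ?mulr1// pnatr_eq0 -lt0n bin_gt0 -ltnS ltn_ord.
Qed.

Lemma intrinsic_vol_steiner r : 0 <= r -> vol (parallel r) =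
  (\sum_(k < d.+1) kappa R (d - k) * intrinsic_vol (hullI p I) k * r ^+ (d - k))%:E.
Proof.
have [c [cE _]] := steiner_balls p I0; rewrite /intrinsic_vol; set P := [set V | _].
have [_] : P (xget (fun=> 0) P); last exact.
apply: xgetPex; exists (fun k => if (k <= d)%N then c (d - k)%N / kappa R (d - k) else 0).
split => [k dk|s s0]; first by rewrite (leqNgt k) dk.
(* The intrinsic volume of index k belongs to r^(d-k), so the sum is reversed. *)
rewrite cE//; congr EFin; rewrite (reindex_inj rev_ord_inj)/=.
apply: eq_bigr => k _; rewrite subSS -ltnS ltn_ord mulrCA mulfV ?mulr1//.
by rewrite gt_eqF// kappa_gt0.
Qed.

Lemma balls_close_parallel : @close_at_infinity R d
  (fun r => fine (vol (\bigcup_(i in [set` I]) cball (p i) r)))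
  (fun r => fine (vol (parallel r))).
Proof.
have [c [cE [C [r0 h]]]] := steiner_balls p I0.
exists C, (Num.max 0 r0) => r; rewrite ge_max => /andP[r_ge0 rr0].
by rewrite cE//=; exact: h.
Qed.

End steiner_coefficients.

(** Volume is additive on [CN], so the flower volume is the combination of the volumes of the unions
    of balls; each of these is close to a parallel body. *)
Lemma flower_vol_close (R : realType) (N d : nat) (f : freeBA N) (p : 'I_N -> 'rV[R]_d)
    (Q : {set 'I_N} -> R -> R) : (0 < N)%N -> CN f ->
  (forall I, I != finset.set0 -> @close_at_infinity R d
    (fun r => fine (vol (minkowski_sum (hullI p I) (cball 0 r)))) (Q I)) ->
  @close_at_infinity R d (flower_vol f p)
    (fun r => \sum_(I : {set 'I_N} | I != finset.set0) (mcoef R f I)%:~R * Q I r).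
Proof.
move=> N0 Cf KQ.
rewrite (_ : flower_vol f p = fun r => \sum_(I : {set 'I_N} | I != finset.set0)
    (mcoef R f I)%:~R * fine (vol (\bigcup_(i in [set` I]) cball (p i) r))).
  by apply: close_sum => I I0; apply: close_trans (KQ I I0); exact: balls_close_parallel.
apply/funext => r; rewrite (mcoefP N0 Cf (flower_vol_additive p r)).
by apply: eq_bigr => I _; rewrite /flower_vol flower_ugen.
Qed.

Lemma eq_close_at_infinity (R : realType) (d : nat) (F G H : R -> R) :
  (forall r, 0 <= r -> F r = G r) -> @close_at_infinity R d G H -> @close_at_infinity R d F H.
Proof.
move=> FG [C [r0 h]]; exists C, (Num.max 0 r0) => r.
by rewrite ge_max => /andP[r_ge0 rr0]; rewrite FG// h.
Qed.

Theorem theorem1 (R : realType) (N d : nat) (hN : (1 <= N)%N) (hd : (1 <= d)%N)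
    (f : freeBA N) (hf : CN f) (p : 'I_N -> 'rV[R]_d) :
  (flower_vol f p : R -> R^o) =
    (fun r => \sum_(d - 2 <= k < d.+1) 'C(d, k)%:R * Wf f k p * r ^+ k)
      +O_ near_pinfty (fun r => r ^ (d%:Z - 3) : R^o) /\
  (flower_vol f p : R -> R^o) =
    (fun r => \sum_(0 <= k < 3 | (k <= d)%N) kappa R (d - k) * Vf f k p * r ^+ (d - k))
      +O_ near_pinfty (fun r => r ^ (d%:Z - 3) : R^o).
Proof.
split; apply: close_bigO => //.
- rewrite (_ : (fun r => _) = fun r => \sum_(I : {set 'I_N} | I != finset.set0)
      (mcoef R f I)%:~R * \sum_(k < d.+1 | (d - 2 <= k)%N)
        'C(d, k)%:R * quermass (hullI p I) k * r ^+ k).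
    apply: flower_vol_close => // I I0.
    apply: (@eq_close_at_infinity _ _ _ (fun r => \sum_(k < d.+1)
      'C(d, k)%:R * quermass (hullI p I) k * r ^+ k)).
      by move=> r r0; rewrite quermass_steiner.
    (* The dropped exponents k < d - 2 satisfy k + 2 <= d - 1; for d <= 2 the truncated difference
       is 0 and nothing is dropped. *)
    apply: (@close_truncate R d d.+1 (fun k => 'C(d, k)%:R * quermass (hullI p I) k) id
      (fun k => d - 2 <= k)%N) => k kd.
    by rewrite -ltnNge ltn_subRL => kd2; rewrite -ltnS (prednK hd) addnC.
  apply/funext => r; rewrite big_geq_mkord.
  under eq_bigr do rewrite /Wf mulr_sumr mulr_suml.
  rewrite exchange_big/=; apply: eq_bigr => I _; rewrite mulr_sumr.
  by apply: eq_bigr => k _; rewrite mulrCA !mulrA.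
- rewrite (_ : (fun r => _) = fun r => \sum_(I : {set 'I_N} | I != finset.set0)
      (mcoef R f I)%:~R * \sum_(k < d.+1 | (k < 3)%N)
        kappa R (d - k) * intrinsic_vol (hullI p I) k * r ^+ (d - k)).
    apply: flower_vol_close => // I I0.
    apply: (@eq_close_at_infinity _ _ _ (fun r => \sum_(k < d.+1)
      kappa R (d - k) * intrinsic_vol (hullI p I) k * r ^+ (d - k))).
      by move=> r r0; rewrite intrinsic_vol_steiner.
    (* An index k with 3 <= k <= d carries the power d - k <= d - 3. *)
    apply: (@close_truncate R d d.+1
      (fun k => kappa R (d - k) * intrinsic_vol (hullI p I) k)
      (fun k => d - k)%N (fun k => k < 3)%N) => k kd.
    rewrite -leqNgt => k3; rewrite -ltnS (prednK hd) -addnS.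
    by rewrite -[X in (_ <= X)%N](subnK (kd : (k <= d)%N)) leq_add2l.
  apply/funext => r.
  have -> : \sum_(0 <= k < 3 | (k <= d)%N) kappa R (d - k) * Vf f k p * r ^+ (d - k) =
      \sum_(k < d.+1 | (k < 3)%N) kappa R (d - k) * Vf f k p * r ^+ (d - k).
    rewrite -(big_mkord (fun k => k < 3)%N (fun k => kappa R (d - k) * Vf f k p * r ^+ (d - k))).
    (* Both sums are extended to k < d + 3, where their conditions k <= d and k < 3 coincide up to
       order. *)
    rewrite (@big_nat_widen _ _ _ 0%N 3%N d.+3)// [RHS](@big_nat_widen _ _ _ 0%N d.+1 d.+3)//;
      last by rewrite leqW.
    by apply: eq_bigl => k; rewrite andbC.
  under eq_bigr do rewrite /Vf mulr_sumr mulr_suml.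
  rewrite exchange_big/=; apply: eq_bigr => I _; rewrite mulr_sumr.
  by apply: eq_bigr => k _; rewrite mulrCA !mulrA.
Qed.
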